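(* Let $\Omega$ be an $SE$-partitionable poset. The (semi-Eulerian) $\mathbf{cd}$-index $\Phi(\Omega)$ can be recursively computed in terms of the $S$-partitionable parts of $\Omega$ of smaller rank, and is consequently non-negative, i.e. all coefficients of $\Phi(\Omega)$, as a polynomial in the non-commuting variables $\mathbf c,\mathbf d$, are non-negative.
   Context: **Posets.** All posets are finite and graded, with a minimum $\hat 0$ of rank $0$ and a maximum $\hat 1$; $r$ is the rank function, ''rank $d+1$'' means $r(\hat 1)=d+1$, and coatoms are the elements of rank $d$. A lower set of elements (for instance $\Gamma_\sigma$, $\partial\Gamma_\sigma$, $\partial\overline\sigma$ below) is regarded as such a poset by adjoining a maximum $\hat 1$; in particular $\{\emptyset\}$ denotes the rank-one poset $\{\hat0<\hat1\}$. For an element $p$, $\overline p=[\hat 0,p]$; for a set $\mathcal C$ of elements, $\overline{\mathcal C}=\bigcup_{p\in\mathcal C}\overline p$ is its closure; and $\partial\overline\sigma=\overline\sigma\setminus\{\sigma\}$. A poset is Eulerian if every interval $[x,y]$ with $x<y$ has as many elements of even rank as of odd rank; it is semi-Eulerian if this holds for every interval $[x,y]\ne[\hat0,\hat1]$ with $x<y$. It is near-Eulerian if it can be obtained from an Eulerian poset by deleting a single coatom. For a near-Eulerian poset $\Gamma$, its boundary $\partial\Gamma$ is the closure of the set of all $y$ such that $[y,\hat1]$ is a three-element chain, and its semisuspension $\tilde\Sigma\Gamma$ is the Eulerian poset obtained from $\Gamma$ by adjoining a new coatom $\tau$ that covers every $y$ such that $[y,\hat 1]$ is a three-element chain. **$S$-partitionable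 posets** (recursive definition). An Eulerian poset $\Omega$ of rank $d+1$ is $S$-partitionable if either $\Omega=\{\emptyset\}$, or $\Omega$ has rank at least $2$ and there is a partition of $\Omega\setminus\{\hat 1\}$ with one class $P_\sigma\subseteq\overline\sigma$ for each coatom $\sigma$ (an $S$-partition) such that, writing $\Gamma_\sigma=\overline{P_\sigma\setminus\{\sigma\}}$: (a) there is a unique initial coatom $\sigma_1$ for which $P_{\sigma_1}=\overline{\sigma_1}$, and $P_{\sigma_1}\setminus\{\sigma_1\}=\partial\overline{\sigma_1}$ is $S$-partitionable of rank $d$; (b) there is a unique terminal coatom $\sigma_t$ for which $P_{\sigma_t}=\{\sigma_t\}$; (c) for every other coatom $\sigma$, $\Gamma_\sigma$ is near-Eulerian of rank $d$ with $\Gamma_\sigma=(P_\sigma\setminus\{\sigma\})\uplus\partial\Gamma_\sigma$ (disjoint union), and $\tilde\Sigma\Gamma_\sigma$ is $S$-partitionable of rank $d$ such that the initial coatom is the added coatom $\tau_\sigma$. **$SE$-partitionable posets.** A semi-Eulerian poset $\Omega$ of rank $d+1$ is $SE$-partitionable if either $\Omega=\{\emptyset\}$, or $\Omega$ has rank at least $2$ and there is a partition of $\Omega\setminus\{\hat1\}$ with one class $P_\sigma\subseteq\overline\sigma$ for each coatom $\sigma$ (an $SE$-partition) such that: (a) there is a unique initial coatom $\sigma_1$ for which $P_{\sigma_1}=\overline{\sigma_1}$, and $P_{\sigma_1}\setminus\{\sigma_1\}$ is $S$-partitionable of rank $d$; (b) for every other coatom $\sigma$, either $P_\sigma=\{\sigma\}$,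 or $P_\sigma\setminus\{\sigma\}$ admits a partition into $k_\sigma$ disjoint sub-classes $P_\sigma^j$ such that each $\Gamma_\sigma^j=\overline{P_\sigma^j}$ satisfies $\Gamma_\sigma^j=P_\sigma^j\uplus\partial\Gamma_\sigma^j$ (disjoint union), is near-Eulerian of rank $d$, and $\tilde\Sigma\Gamma_\sigma^j$ is $S$-partitionable of rank $d$ such that the initial coatom is the added coatom $\tau_\sigma^j$. The $S$-partitionable parts of smaller rank are the posets arising from an $SE$-partition: $\partial\overline{\sigma_1}$ (rank $d$) and, for each non-initial coatom $\sigma$ with $P_\sigma\ne\{\sigma\}$ and each $j$, $\tilde\Sigma\Gamma_\sigma^j$ (rank $d$) and $\partial\Gamma_\sigma^j$ (rank $d-1$; it is $S$-partitionable by (a) of the definition of $S$-partitionability applied to $\tilde\Sigma\Gamma_\sigma^j$). **$\mathbf{cd}$-index.** For a poset $\Omega$ of rank $d+1$ and $K\subseteq[d]$, $f_K(\Omega)$ is the number of chains whose set of ranks is $K$. Let $\chi(\Omega)$ be the Euler characteristic of $\Omega$, i.e. of its order complex (the simplicial complex of chains of $\Omega\setminus\{\hat0,\hat1\}$), and let $\mathbb S^{d-1}$ be the $(d-1)$-dimensional sphere. Put $f'_K(\Omega)=f_K(\Omega)$ for $K\ne\{d\}$ and $f'_{\{d\}}(\Omega)=f_{\{d\}}(\Omega)+\chi(\mathbb S^{d-1})-\chi(\Omega)$. Let $\mathbf a,\mathbf b$ be non-commuting variables and $u_K=u_1\cdots u_d$ with $u_i=\mathbf b$ if $i\in K$ and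 $u_i=\mathbf a$ if $i\notin K$, and let $\chi'_\Omega(\mathbf a,\mathbf b)=\sum_{K\subseteq[d]}f'_K(\Omega)u_K$. For $\Omega$ semi-Eulerian, the $\mathbf{cd}$-index $\Phi(\Omega)=\Phi_\Omega(\mathbf c,\mathbf d)$ is the unique polynomial in non-commuting variables $\mathbf c,\mathbf d$ with $\Phi_\Omega(\mathbf a+\mathbf b,\mathbf{ab}+\mathbf{ba})=\chi'_\Omega(\mathbf a-\mathbf b,\mathbf b)$; it exists for every semi-Eulerian poset (Juhnke-Kubitzke–Samper–Venturello). If $\Omega$ is Eulerian, this is the usual $\mathbf{cd}$-index. *)

(* Defs.v *)
(* MathComp, with the monoid algebras of multinomials for polynomials in
   non-commuting variables. *)
From Stdlib Require Import ClassicalEpsilon.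
From HB Require Import structures.
From mathcomp Require Import all_boot all_order all_algebra.
From mathcomp Require Import finmap monalg.

Set Implicit Arguments.
Unset Strict Implicit.
Unset Printing Implicit Defensive.

Import Order.TTheory GRing.Theory Num.Theory.

Local Open Scope order_scope.

(* A poset is a [finPOrderType]; the existence of a minimum and of a maximum,
   and gradedness, are carried by the predicate [graded]. *)
Section Posets.
Context {disp : Order.disp_t} (T : finPOrderType disp).
Implicit Types (x y z : T) (A C : {set T}).

Definition is_bot x := [forall y, x <= y].
Definition is_top x := [forall y, y <= x].

Definition covered_by x y := (x < y) && [forall z, ~~ (x < z < y)].

Definition chain C := [forall x in C, forall y in C, x >=< y].

Definition below x : {set T} := [set y | y < x].

(* The length of a longest chain descending from [x]; in a graded poset with a
   minimum this is the value at [x] of the rank function. *)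
Definition rank x : nat :=
  (\max_(C : {set T} | chain C && (C \subset below x)) #|C|)%N.

Definition graded : Prop :=
  [/\ exists x, is_bot x,
      exists x, is_top x
    & forall x y, covered_by x y -> rank y = (rank x).+1].

Definition rk : nat := (\max_(x : T) rank x)%N.

Definition coatoms : {set T} := [set x | (rank x).+1 == rk].

Definition balanced x y : Prop :=
  #|[set z | (x <= z <= y) && ~~ odd (rank z)]|
  = #|[set z | (x <= z <= y) && odd (rank z)]|.

Definition eulerian : Prop :=
  graded /\ (forall x y, x < y -> balanced x y).

Definition semi_eulerian : Prop :=
  graded /\
  (forall x y, x < y -> ~~ (is_bot x && is_top y) -> balanced x y).

Definition ideal x : {set T} := [set y | y <= x].

Definition down_closure A : {set T} := [set y | [exists x in A, y <= x]].

(* In a poset with a maximum, [y, 1] is the set of elements above [y]; when it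
   has three elements it is a chain, as two of them are its bounds. *)
Definition boundary : {set T} :=
  down_closure [set y | #|[set z | y <= z]| == 3].

Definition coatom_partition (P : T -> {set T}) : Prop :=
  [/\ {in coatoms &, injective P},
      partition [set P s | s in coatoms] [set x | ~~ is_top x]
    & {in coatoms, forall s, P s \subset ideal s}].

End Posets.

Arguments boundary {disp} T.
Arguments coatoms {disp} T.
Arguments rk {disp} T.
Arguments graded {disp} T.
Arguments eulerian {disp} T.
Arguments semi_eulerian {disp} T.

Definition near_eulerian {disp : Order.disp_t} (T : finPOrderType disp) :
    Prop :=
  graded T /\
  exists (Q : finPOrderType disp) (tau : Q) (f : T -> Q),
    [/\ eulerian Q, tau \in coatoms Q, {mono f : x y / x <= y}
      & f @: [set: T] = [set~ tau]].

(* The poset obtained from a set [A] of elements by adjoining a maximum [None];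
   it is only used for lower sets [A]. *)
Definition lower {disp : Order.disp_t} {T : finPOrderType disp}
  (A : {set T}) : Type := option {x : T | x \in A}.

Section Lower.
Context {disp : Order.disp_t} {T : finPOrderType disp} (A : {set T}).

Definition lower_le (u v : lower A) : bool :=
  match u, v with
  | Some x, Some y => val x <= val y
  | _, None => true
  | None, Some _ => false
  end.

Fact lower_le_refl : reflexive lower_le.
Proof. by case=> [x|] //=. Qed.

Fact lower_le_anti : antisymmetric lower_le.
Proof.
case=> [x|] [y|] //= xy; congr Some; apply: val_inj; exact: le_anti.
Qed.

Fact lower_le_trans : transitive lower_le.
Proof. case=> [y|] [x|] [z|] //=; exact: le_trans. Qed.

HB.instance Definition _ := Finite.on (lower A).
HB.instance Definition _ := Order.Le_isPOrder.Build disp (lower A)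
  lower_le_refl lower_le_anti lower_le_trans.

(* The boundary of [lower A], as a set of elements of the ambient poset. *)
Definition lower_boundary : {set T} :=
  [set val x | x : {x : T | x \in A}
             & (Some x : lower A) \in boundary (lower A)].

End Lower.

(* [None] is the added coatom: below it is the boundary, above it only the
   maximum. *)
Definition semisuspension {disp : Order.disp_t} (T : finPOrderType disp) :
  Type := option T.

Section Semisuspension.
Context {disp : Order.disp_t} (T : finPOrderType disp).

Definition semisuspension_le (u v : semisuspension T) : bool :=
  match u, v with
  | Some x, Some y => x <= y
  | Some x, None => x \in boundary T
  | None, Some y => is_top y
  | None, None => true
  end.

Fact is_top_boundaryF (x : T) : is_top x -> x \in boundary T -> False.
Proof.
move=> /forallP xtop; rewrite inE => /existsP[y /andP[+ xy]].
have /eqP <- : x == y by rewrite eq_le xy xtop.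
rewrite inE => /eqP x3.
suff eq1 : [set z | x <= z] = [set x] by move: x3; rewrite eq1 cards1.
by apply/setP => z; rewrite !inE eq_le xtop.
Qed.

Fact semisuspension_le_refl : reflexive semisuspension_le.
Proof. by case=> [x|] //=. Qed.

Fact semisuspension_le_anti : antisymmetric semisuspension_le.
Proof.
case=> [x|] [y|] //=.
- by move=> /le_anti ->.
- by case/andP=> xb xt; case: (is_top_boundaryF xt xb).
- by case/andP=> xt xb; case: (is_top_boundaryF xt xb).
Qed.

Fact semisuspension_le_trans : transitive semisuspension_le.
Proof.
case=> [y|] [x|] [z|] //=.
- exact: le_trans.
- move=> xy; rewrite !inE => /existsP[w /andP[wb yw]].
  by apply/existsP; exists w; rewrite wb (le_trans xy).
- by move=> /forallP yt yz; apply/forallP => w; apply: le_trans (yt w) yz.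
- by move=> xb /forallP.
Qed.

HB.instance Definition _ := Finite.on (semisuspension T).
HB.instance Definition _ := Order.Le_isPOrder.Build disp (semisuspension T)
  semisuspension_le_refl semisuspension_le_anti semisuspension_le_trans.

End Semisuspension.

(* [S_partitionable_from T s1] means that [T] has rank at least 2 and has an
   S-partition whose initial coatom is [s1].  The recursion is well founded
   because the rank decreases, so that the least solution is the only one. *)
Inductive S_partitionable {disp : Order.disp_t} :
    forall T : finPOrderType disp, Prop :=
  | S_partitionable_rank1 (T : finPOrderType disp) of
      eulerian T & rk T = 1%N : S_partitionable T
  | S_partitionable_rank_ge2 (T : finPOrderType disp) (s1 : T) of
      S_partitionable_from s1 : S_partitionable T
with S_partitionable_from {disp : Order.disp_t} :
    forall T : finPOrderType disp, T -> Prop :=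
  | S_partition (T : finPOrderType disp) (P : T -> {set T}) (s1 st : T) of
      eulerian T & (2 <= rk T)%N & coatom_partition P
    & s1 \in coatoms T & P s1 = ideal s1
    & {in coatoms T, forall s, P s = ideal s -> s = s1}
    & S_partitionable (lower (P s1 :\ s1)) & (rk (lower (P s1 :\ s1))).+1 = rk T
    & st \in coatoms T & P st = [set st]
    & {in coatoms T, forall s, P s = [set s] -> s = st}
    & {in coatoms T, forall s, s != s1 -> s != st ->
        let G := down_closure (P s :\ s) in
        [/\ near_eulerian (lower G), (rk (lower G)).+1 = rk T,
            G = (P s :\ s) :|: lower_boundary G
          & [disjoint P s :\ s & lower_boundary G]]}
    & {in coatoms T, forall s, s != s1 -> s != st ->
        S_partitionable_from
          (None : semisuspension (lower (down_closure (P s :\ s))))} :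
    S_partitionable_from s1.

Arguments S_partitionable {disp} T.

(* [Q s] is the set of sub-classes of the class [P s]; it is irrelevant for the
   coatoms [s] such that [P s = [set s]]. *)
Definition SE_partition {disp : Order.disp_t} (T : finPOrderType disp)
    (s1 : T) (P : T -> {set T}) (Q : T -> {set {set T}}) : Prop :=
  [/\ (2 <= rk T)%N,
      coatom_partition P,
      [/\ s1 \in coatoms T, P s1 = ideal s1,
          {in coatoms T, forall s, P s = ideal s -> s = s1},
          S_partitionable (lower (P s1 :\ s1))
        & (rk (lower (P s1 :\ s1))).+1 = rk T]
    & {in coatoms T, forall s, s != s1 ->
        P s = [set s] \/
        partition (Q s) (P s :\ s) /\
        {in Q s, forall B, let G := down_closure B in
          [/\ G = B :|: lower_boundary G,
              [disjoint B & lower_boundary G],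
              near_eulerian (lower G),
              (rk (lower G)).+1 = rk T
            & S_partitionable_from (None : semisuspension (lower G))]}}].

Definition SE_partitionable {disp : Order.disp_t} (T : finPOrderType disp) :
    Prop :=
  semi_eulerian T /\
  (rk T = 1%N \/ exists s1 P Q, @SE_partition disp T s1 P Q).

Lemma lt_rank {disp : Order.disp_t} (T : finPOrderType disp) (x y : T) :
  x < y -> (rank x < rank y)%N.
Proof.
move=> xy; rewrite {1}/rank.
have [|C /andP[/forall_inP chC Cx] ->] := @eq_bigmax_cond {set T}
    [pred C | chain C && (C \subset below x)] (fun C => #|C|).
  apply/card_gt0P; exists set0; rewrite inE sub0set andbT.
  by apply/forallP => z; rewrite inE.
have xC : x \notin C by apply/negP => /(subsetP Cx); rewrite inE ltxx.
have ltC z : z \in C -> z <= x by move/(subsetP Cx); rewrite inE => /ltW.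
have -> : #|C|.+1 = #|x |: C| by rewrite cardsU1 xC.
apply: (@leq_bigmax_cond _
  [pred C | chain C && (C \subset below y)] (fun C => #|C|)).
apply/andP; split.
  apply/forall_inP => z; rewrite !inE => zC.
  apply/forall_inP => t; rewrite !inE => tC.
  case/orP: zC => [/eqP -> | zC]; case/orP: tC => [/eqP -> | tC].
  - exact: comparablexx.
  - by rewrite comparable_sym; apply: le_comparable; apply: ltC.
  - by apply: le_comparable; apply: ltC.
  - by move/forall_inP: (chC z zC); apply.
apply/subsetP => z; rewrite !inE => /orP[/eqP -> // | /(subsetP Cx)].
by rewrite inE => /lt_trans; apply.
Qed.

Lemma coatom_in_class {disp : Order.disp_t} (T : finPOrderType disp)
    (P : T -> {set T}) (s : T) :
  coatom_partition P -> s \in coatoms T -> s \in P s.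
Proof.
case=> _ /and3P[/eqP cov _ _] sub sc.
have : s \in cover [set P x | x in coatoms T].
  rewrite cov inE; apply/negP => /forallP stop.
  suff : (rk T <= rank s)%N by move: sc; rewrite inE => /eqP <-; rewrite ltnn.
  apply/bigmax_leqP => y _.
  by have := stop y; rewrite le_eqVlt => /orP[/eqP -> // | /lt_rank /ltnW].
case/bigcupP => _ /imsetP[t tc ->] sPt.
have := subsetP (sub _ tc) _ sPt; rewrite inE le_eqVlt.
case/orP => [/eqP {2}-> // | /lt_rank].
by move: sc tc; rewrite !inE => /eqP <- /eqP [->]; rewrite ltnn.
Qed.

(* Hence a formula for the posets with an SE-partition applies again to their
   S-partitionable parts. *)
Lemma S_partitionable_SE {disp : Order.disp_t} (T : finPOrderType disp) :
  S_partitionable T -> SE_partitionable T.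
Proof.
have semi (U : finPOrderType disp) : eulerian U -> semi_eulerian U.
  by case=> gU eU; split=> // x y xy _; apply: eU.
case=> {}T.
  by move=> eT r1; split; [apply: semi | left].
move=> s1 [] {s1}{}T P s1 st eT r2 cP s1c Ps1 u1 S1 rk1 stc Pst ut hN hS.
split; [exact: semi | right].
exists s1, P, (fun s => [set P s :\ s]); split=> // s sc ss1.
have [-> | sst] := eqVneq s st; first by left.
right; have [nG rG eG dG] := hN s sc ss1 sst.
have nz : P s :\ s != set0.
  apply: contra_neq sst => Ps0; apply: ut => //.
  by rewrite -(setD1K (coatom_in_class cP sc)) Ps0 setU0.
split.
  apply/and3P; split.
  - by rewrite /cover big_set1.
  - by apply/trivIsetP => A B; rewrite !inE => /eqP -> /eqP ->; rewrite eqxx.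
  - by rewrite inE eq_sym.
by move=> B; rewrite inE => /eqP ->; split=> //; apply: hS.
Qed.

Local Open Scope ring_scope.

(* The set of [i.+1] for [i \in K] is the set of ranks in {1, ..., d}, where
   [d.+1] is the rank of the poset. *)
Definition flag_f {disp : Order.disp_t} (T : finPOrderType disp)
    (K : {set 'I_(rk T).-1}) : nat :=
  #|[set C : {set T} | [&& chain C,
      [forall x in C, exists i in K, rank x == i.+1]
    & [forall i in K, exists x in C, rank x == i.+1]]]|.

Definition euler_char {disp : Order.disp_t} (T : finPOrderType disp) : int :=
  \sum_(C : {set T} | [&& chain C, C != set0
                        & [forall x in C, ~~ is_bot x && ~~ is_top x]])
    (-1) ^+ (#|C|).-1.

(* The Euler characteristic of the sphere of dimension [d - 1], which is empty
   for [d = 0]. *)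
Definition sphere_euler_char (d : nat) : int := 1 - (-1) ^+ d.

Definition flag_f' {disp : Order.disp_t} (T : finPOrderType disp)
    (K : {set 'I_(rk T).-1}) : int :=
  let d := (rk T).-1 in
  if (0 < d)%N && (K == [set i : 'I_d | i.+1 == d])
  then (flag_f K)%:Z + sphere_euler_char d - euler_char T
  else (flag_f K)%:Z.

(* The value of the polynomial chi' at elements [x], [y] of a ring. *)
Definition flag_poly {disp : Order.disp_t} (T : finPOrderType disp)
    (R : nzRingType) (x y : R) : R :=
  \sum_(K : {set 'I_(rk T).-1})
    (\prod_(i < (rk T).-1) (if i \in K then y else x)) *~ flag_f' K.

(* Polynomials with integer coefficients in two non-commuting variables, both
   for [a], [b] and for [c], [d]; the letter [false] is [a] or [c], the letter
   [true] is [b] or [d]. *)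
Notation ncpoly := {malg int[{fmonom bool}]}.

Definition ncvar (l : bool) : ncpoly := << fmu l >>.

Definition nceval (R : nzRingType) (x y : R) (p : ncpoly) : R :=
  mmap intr (fun m : {fmonom bool} =>
    \prod_(l <- (m : seq bool)) (if l then y else x)) p.

Definition is_cd_index {disp : Order.disp_t} (T : finPOrderType disp)
    (Phi : ncpoly) : Prop :=
  let a := ncvar false in let b := ncvar true in
  nceval (a + b) (a * b + b * a) Phi = flag_poly T (a - b) b.

(* Unspecified when no polynomial satisfies [is_cd_index T]. *)
Definition cd_index {disp : Order.disp_t} (T : finPOrderType disp) : ncpoly :=
  epsilon (inhabits 0) (is_cd_index T).

(* Main.v *)
Require Import Defs.
From Stdlib Require Import ClassicalEpsilon.
From HB Require Import structures.
From mathcomp Require Import all_boot all_order all_algebra.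
From mathcomp Require Import finmap monalg ring.

Set Implicit Arguments.
Unset Strict Implicit.
Unset Printing Implicit Defensive.

Import Order.TTheory GRing.Theory Num.Theory.

Local Open Scope ring_scope.

(** The flag polynomial of a poset is a sum over its chains.  Sorting the chains
by their maximum turns it into a sum, over all elements [z] but the maximum of
the poset, of a [weight] that depends only on the elements below [z] and on the
length of the words ([sum_flag_f]).  Weights therefore add up over a partition
of the elements, and they do not change when a lower set is seen as a poset in
its own right or as a part of its semisuspension ([emb_weight]).

In an SE-partition, let [p] be the sum of the weights of a sub-class, [G] its
closure and [q] the flag polynomial of the boundary of [G].  As the sub-class is
[G] minus its boundary, the flag polynomial of the semisuspension of [G] is
[p + q * (x + y)].  The coatoms remain: the weight of a coatom is the sum of the
weights of the elements below it, times [y], so that their total counts each [z] as often as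
there are coatoms above [z].  Euler's relation for the intervals from [z] to the
maximum, in the poset and in all semisuspensions containing [z], evaluates this
number: it is 2 plus the number of boundaries that contain [z]
([coatoms_above]).  The minimum is the only exception in a semi-Eulerian poset,
and there the defect is the correction that distinguishes the numbers f' from
the numbers f ([flag_poly_semi]).  Collecting the terms gives a recursion for
flag polynomials in any ring ([flag_poly_recursion]); at [x = a - b] and
[y = b] its factors on the right are the values of c and d.

The substitution of [a + b] for c and [ab + ba] for d is injective
([cd_eval_inj]), so a polynomial that satisfies the defining equation is the
cd-index.  By induction on the rank the right-hand side of the recursion is such
a polynomial.  The induction applies to the boundary of a sub-class because it
is isomorphic to the part below the initial coatom of the semisuspension; as
that coatom is initial, Phi(semisuspension) - Phi(boundary) c is the part of the
recursion for the semisuspension that remains after its first term.  Hence all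
terms of the recursion are non-negative if those of smaller rank are
([cd_index_SE]). *)

(** * Injectivity of the substitution a + b, ab + ba *)

Section NcEval.
Variables (R : nzRingType) (x y : R).

Definition word_value (m : {fmonom bool}) : R :=
  \prod_(l <- (m : seq bool)) (if l then y else x).

Fact word_value_mmorphism : mmorphism word_value.
Proof.
split=> [m1 m2|]; rewrite /word_value ?fmM ?big_cat //.
by rewrite fm1 big_nil.
Qed.

HB.instance Definition _ :=
  isMultiplicative.Build {fmonom bool} R word_value word_value_mmorphism.

HB.instance Definition _ := GRing.Additive.copy (nceval x y)
  (mmap intr word_value).

(** The ring may be non-commutative: only the integer coefficients have to
commute with the values of words. *)
Fact nceval_monoid_morphism : monoid_morphism (nceval x y).
Proof.
have [|hM h1] := @commr_mmap_is_multiplicative {fmonom bool} int R intr word_value.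
  by move=> g m m'; apply: commr_sym; apply: commr_int.
by split.
Qed.

HB.instance Definition _ := GRing.isMonoidMorphism.Build ncpoly R
  (nceval x y) nceval_monoid_morphism.

Lemma nceval_var l : nceval x y (ncvar l) = if l then y else x.
Proof.
rewrite /nceval /ncvar mmapU mul1r.
by rewrite fmU big_seq1.
Qed.

End NcEval.

Definition word_coef (p : ncpoly) (w : seq bool) : int := p@_(FMonom w).

Lemma word_coef_mulvar l p w :
  word_coef (ncvar l * p) w = if w is l' :: w' then word_coef p w' *+ (l' == l) else 0.
Proof.
rewrite {1}[p]monalgE mulr_sumr /word_coef raddf_sum /=.
under eq_bigr => k _.
  have -> : ncvar l * << p@_k *g k >> = << p@_k *g mmul (fmu l) k >>.
    by rewrite /ncvar malgM_def fgmulUU mul1r.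
  rewrite mcoeffU fmP fmM fmU /=; over.
case: w => [|l' w]; first by rewrite big1.
rewrite -/(word_coef p w).
transitivity (\sum_(k <- msupp p) word_coef << p@_k *g k >> w *+ (l' == l)).
  apply: eq_bigr => k _; rewrite /word_coef mcoeffU fmP /= eqseq_cons mulrb.
  by rewrite [l == l']eq_sym; case: (l' == l); rewrite ?mulr0n ?mulr1n ?mulrb.
by rewrite sumrMnl /word_coef {3}[p]monalgE raddf_sum.
Qed.

Lemma word_coef1 w : word_coef 1 w = (w == [::])%:R.
Proof. by rewrite /word_coef mcoeff1 fmP fm1. Qed.

(** Let [f] give the coefficients of p = k + (a + b) p1 + (ab + ba) p2, with a
constant k.  Removing a first letter a, respectively b, from p leaves p1 + b p2,
respectively p1 + a p2.  Hence removing a further b from the difference of the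
two leaves p2, and then p1 is the first of them minus b p2. *)
Definition d_quotient (f : seq bool -> int) (w : seq bool) : int :=
  f [:: false, true & w] - f [:: true, true & w].

Definition c_quotient (f : seq bool -> int) (w : seq bool) : int :=
  f (false :: w) - (if w is true :: w' then d_quotient f w' else 0).

(** The coefficient of the word [m] in c and d, read off from the expansion in a
and b by removing the letters of [m] from the left. *)
Fixpoint cd_coef (m : seq bool) (f : seq bool -> int) : int :=
  match m with
  | [::] => f [::]
  | false :: m' => cd_coef m' (c_quotient f)
  | true :: m' => cd_coef m' (d_quotient f)
  end.

Lemma eq_cd_coef m f g : f =1 g -> cd_coef m f = cd_coef m g.
Proof.
elim: m f g => [|[] m IH] f g fg //=; apply: IH => w; rewrite /c_quotient /d_quotient ?fg //.
by case: w => [|[] w] //; rewrite !fg.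
Qed.

Lemma cd_coef0 m : cd_coef m (fun=> 0) = 0.
Proof.
elim: m => [|l m IH] //=.
by case: l; rewrite -[RHS]IH; apply: eq_cd_coef => -[|[] w];
  rewrite /c_quotient /d_quotient /= ?subrr.
Qed.

Lemma cd_coefB m f g :
  cd_coef m (fun w => f w - g w) = cd_coef m f - cd_coef m g.
Proof.
elim: m f g => [|l m IH] f g //=.
by case: l; rewrite -IH; apply: eq_cd_coef => -[|[] w];
  rewrite /c_quotient /d_quotient ?subr0 // !opprB ?opprD ?opprB !addrA;
  ring.
Qed.

Definition cd_coef_of (m : seq bool) (p : ncpoly) : int := cd_coef m (word_coef p).

Fact cd_coef_of_is_zmod_morphism m : zmod_morphism (cd_coef_of m).
Proof.
move=> p q; rewrite /cd_coef_of -cd_coefB; apply: eq_cd_coef => w.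
exact: mcoeffB.
Qed.

HB.instance Definition _ m := GRing.isZmodMorphism.Build ncpoly int
  (cd_coef_of m) (cd_coef_of_is_zmod_morphism m).

Local Notation cd_eval :=
  (nceval (ncvar false + ncvar true)
          (ncvar false * ncvar true + ncvar true * ncvar false)).

Lemma word_coefD p q w : word_coef (p + q) w = word_coef p w + word_coef q w.
Proof. exact: mcoeffD. Qed.

Lemma ncword_cons l w :
  << FMonom (l :: w) >> = ncvar l * << FMonom w >> :> ncpoly.
Proof.
rewrite /ncvar malgM_def fgmulUU mulr1; congr (<< _ >>).
by apply/eqP; rewrite fmP fmM fmU.
Qed.

Lemma ncword0 : << FMonom [::] >> = 1 :> ncpoly.
Proof. by apply/malgP => m; rewrite mcoeff1 mcoeffU fmP eq_sym fmP fm1. Qed.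

Lemma word_coef_mulc p w :
  word_coef ((ncvar false + ncvar true) * p) w
  = if w is _ :: w' then word_coef p w' else 0.
Proof.
rewrite mulrDl word_coefD.
(* the two products are replaced at once: comparing them would unfold both *)
apply: etrans (congr2 +%R (word_coef_mulvar _ _ _) (word_coef_mulvar _ _ _)) _.
by case: w => [|[] w]; rewrite ?addr0 ?add0r.
Qed.

Lemma word_coef_muld p w :
  word_coef ((ncvar false * ncvar true + ncvar true * ncvar false) * p) w
  = if w is [:: l1, l2 & w'] then if l1 == l2 then 0 else word_coef p w' else 0.
Proof.
rewrite mulrDl word_coefD.
apply: etrans (congr2 (fun u v => word_coef u w + word_coef v w)
  (esym (mulrA (ncvar false) (ncvar true) p))
  (esym (mulrA (ncvar true) (ncvar false) p))) _.
apply: etrans (congr2 +%R (word_coef_mulvar _ _ _) (word_coef_mulvar _ _ _)) _.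
case: w => [|l [|l' w]]; first by rewrite addr0.
  apply: etrans (congr2 (fun x y => x *+ _ + y *+ _)
    (word_coef_mulvar _ _ _) (word_coef_mulvar _ _ _)) _.
  by rewrite !mul0rn addr0.
apply: etrans (congr2 (fun x y => x *+ _ + y *+ _)
  (word_coef_mulvar _ _ _) (word_coef_mulvar _ _ _)) _.
by case: l l' => -[]; rewrite ?addr0 ?add0r.
Qed.

Lemma cd_coef_word m w :
  cd_coef_of m (cd_eval << FMonom w >>) = (m == w)%:R.
Proof.
elim: m w => [|l m IH] [|l' w]; rewrite /cd_coef_of.
- by rewrite ncword0 rmorph1 /= word_coef1.
- rewrite ncword_cons rmorphM /= nceval_var /=.
  by case: l'; rewrite ?word_coef_mulc ?word_coef_muld.
- rewrite ncword0 rmorph1 -[RHS](cd_coef0 m) /=.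
  by case: l; apply: eq_cd_coef => -[|[] v];
    rewrite /c_quotient /d_quotient !word_coef1 ?subr0.
- rewrite ncword_cons rmorphM /= nceval_var eqseq_cons.
  have {IH} := IH w; rewrite /cd_coef_of; move: (nceval _ _ _) => E IH.
  have [->|ll'] := eqVneq l l'; rewrite /= -?IH -?[RHS](cd_coef0 m).
    case: l'; apply: eq_cd_coef; case=> [|[] v];
    by rewrite /c_quotient /d_quotient /= ?word_coef_mulc ?word_coef_muld /=
               ?subr0 ?subrr ?subr0.
  case: l l' ll' => -[] // _; apply: eq_cd_coef; case=> [|[] v];
    by rewrite /c_quotient /d_quotient /= ?word_coef_mulc ?word_coef_muld /=
               ?subr0 ?subrr ?subr0.
Qed.

Lemma eq_on_words (f g : {additive ncpoly -> int}) :
  (forall w, f << FMonom w >> = g << FMonom w >>) -> f =1 g.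
Proof.
move=> fg p.
have E (h : {additive ncpoly -> int}) :
    h p = \sum_(k <- msupp p) h << k >> *~ p@_k.
  rewrite {1}[p]monalgE raddf_sum; apply: eq_bigr => k _.
  rewrite -raddfMz; congr (h _); apply/malgP => m.
  transitivity ((<< k >> : ncpoly)@_m *~ p@_k); last exact: esym (raddfMz (mcoeff m) _ _).
  rewrite mcoeffU mcoeffU1.
  by case: (k == m); rewrite ?mul0rz // intz.
by rewrite !E; apply: eq_bigr => -[w] _; rewrite fg.
Qed.

Lemma cd_coef_eval m p : cd_coef_of m (cd_eval p) = word_coef p m.
Proof.
have wc_zmod : zmod_morphism (word_coef^~ m) by move=> f g; apply: mcoeffB.
pose wcA := GRing.isZmodMorphism.Build ncpoly int (word_coef^~ m) wc_zmod.
pose wc : {additive ncpoly -> int} := HB.pack (word_coef^~ m) wcA.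
apply: (eq_on_words (f := cd_coef_of m \o cd_eval) (g := wc)) p => w.
apply: etrans (cd_coef_word m w) _; rewrite /= /word_coef mcoeffU1 fmP /= eq_sym.
by case: eqP.
Qed.

(** [cd_coef_of] is a left inverse, coefficient by coefficient. *)
Lemma cd_eval_inj : injective cd_eval.
Proof.
move=> p q pq; apply/malgP => -[m].
by have := cd_coef_eval m p; rewrite pq cd_coef_eval /word_coef => ->.
Qed.

Lemma cd_index_unique disp (T : finPOrderType disp) Phi :
  is_cd_index T Phi -> unique (is_cd_index T) (cd_index T) /\ cd_index T = Phi.
Proof.
move=> PhiT; have cdT : is_cd_index T (cd_index T).
  by apply: epsilon_spec; exists Phi.
suff u Psi : is_cd_index T Psi -> cd_index T = Psi by split; [split|apply: u].
by move=> PsiT; apply: cd_eval_inj; rewrite [LHS]cdT [RHS]PsiT.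
Qed.

(** * Ranks, signs and embeddings of lower sets *)

Section PosetBasics.
Context {disp : Order.disp_t} {T : finPOrderType disp}.
Implicit Types (x y z : T) (C D : {set T}).
Local Open Scope order_scope.

Lemma chainP C : reflect {in C &, forall x y, x >=< y} (chain C).
Proof.
apply: (iffP forall_inP) => [chC x y xC yC|chC x xC].
  by have /forall_inP := chC x xC; apply.
by apply/forall_inP => y; apply: chC.
Qed.

Lemma chain_sub C D : C \subset D -> chain D -> chain C.
Proof. by move=> /subsetP CD /chainP chD; apply/chainP=> x y /CD xD /CD; apply: chD. Qed.

Lemma leq_rank x y : x <= y -> (rank x <= rank y)%N.
Proof. by rewrite le_eqVlt => /predU1P[->//|/lt_rank/ltnW]. Qed.

Lemma chain_rank_lt C x y : chain C -> x \in C -> y \in C ->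
  (rank x < rank y)%N -> x < y.
Proof.
move=> /chainP chC xC yC xy; have := chC x y xC yC.
rewrite /Order.comparable le_eqVlt => /orP[/predU1P[e|//]|/leq_rank].
  by rewrite e ltnn in xy.
by rewrite leqNgt xy.
Qed.

Lemma chain_rank_inj C x y : chain C -> x \in C -> y \in C ->
  rank x = rank y -> x = y.
Proof.
move=> /chainP chC xC yC xy; have := chC x y xC yC; rewrite /Order.comparable.
by rewrite !le_eqVlt => /orP[]/predU1P[//|/lt_rank]; rewrite xy ltnn.
Qed.

(** The largest element of a longest chain below [x] has the rank of [x] minus
one.  In this recursive form the rank visibly depends only on [below x]. *)
Lemma rankE x : rank x = (\max_(y | (y < x)%O) (rank y).+1)%N.
Proof.
apply/eqP; rewrite eqn_leq; apply/andP; split; last first.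
  by apply/bigmax_leqP => y /lt_rank.
apply/bigmax_leqP => C /andP[chC /subsetP Cx].
have [->|[z zC]] := set_0Vmem C; first by rewrite cards0.
case: (arg_maxnP (P := [in C]) (@rank _ T) zC) => y yC ymax.
have /Cx := yC; rewrite inE => yx.
apply: leq_trans (@leq_bigmax_cond _ (fun y => y < x) (fun y : T => (rank y).+1) y yx).
rewrite (cardsD1 y) yC add1n ltnS.
apply: (@leq_bigmax_cond _ [pred C | chain C && (C \subset below y)]
  (fun C : {set T} => #|C|)) => /=.
rewrite (chain_sub _ chC) ?subD1set //=.
apply/subsetP => w; rewrite !inE => /andP[wy wC].
rewrite lt_neqAle wy /=; have := ymax w wC => /=.
rewrite leqNgt; apply: contraNT => wNy.
have /chainP/(_ w y wC yC) := chC; rewrite /Order.comparable (negbTE wNy) /=.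
by rewrite le_eqVlt eq_sym (negbTE wy) /= => /lt_rank.
Qed.

Lemma rank_le_rk x : (rank x <= rk T)%N.
Proof. exact: leq_bigmax. Qed.

Lemma bot_rank0 x : is_bot x -> rank x = 0%N.
Proof.
move=> /forallP bx; rewrite rankE big1 // => y yx.
by have := lt_le_trans yx (bx y); rewrite ltxx.
Qed.

Lemma top_rank x : is_top x -> rank x = rk T.
Proof.
move=> /forallP xt; apply/eqP; rewrite eqn_leq rank_le_rk /=.
by apply/bigmax_leqP => y _; apply: leq_rank.
Qed.

Definition sgn x : int := ((-1) ^+ rank x)%R.

Lemma balanced_sum x y : balanced x y -> (\sum_(z | (x <= z <= y)%O) sgn z = 0)%R.
Proof.
rewrite /balanced => b; rewrite (bigID (fun z => ~~ odd (rank z))) /=.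
set A := [set z | _] in b; set B := [set z | _] in b.
have -> : (\sum_(z | (x <= z <= y)%O && ~~ odd (rank z)) sgn z = #|A|%:R)%R.
  rewrite -sum1_card natr_sum; apply: eq_big => z; first by rewrite inE.
  by case/andP=> _ o; rewrite /sgn -signr_odd (negbTE o).
have -> : (\sum_(z | (x <= z <= y)%O && ~~ ~~ odd (rank z)) sgn z = - #|B|%:R)%R.
  rewrite -sum1_card natr_sum -sumrN; apply: eq_big => z; rewrite negbK ?inE //.
  by case/andP=> _ o; rewrite /sgn -signr_odd o.
by rewrite b subrr.
Qed.

End PosetBasics.

Section Graded.
Context {disp : Order.disp_t} {T : finPOrderType disp} (gT : graded T).
Implicit Types (x y z : T).
Local Open Scope order_scope.

Lemma graded_bot : exists2 x : T, is_bot x & rank x = 0%N.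
Proof. by case: gT => -[x bx] _ _; exists x => //; apply: bot_rank0. Qed.

Lemma rank_eq0 x : (rank x == 0%N) = is_bot x.
Proof.
apply/idP/idP => [/eqP r0|/bot_rank0 -> //].
have [b bb _] := graded_bot; have /forallP/(_ x) := bb.
by rewrite le_eqVlt => /predU1P[<- //|/lt_rank]; rewrite r0.
Qed.

Lemma rank_eq_rk x : (rank x == rk T) = is_top x.
Proof.
apply/idP/idP => [/eqP r0|/top_rank -> //].
case: gT => _ [t tt] _; have /forallP/(_ x) := tt.
by rewrite le_eqVlt => /predU1P[-> //|/lt_rank]; rewrite r0 (top_rank tt) ltnn.
Qed.

Lemma rank_lt_rk x : (rank x < rk T)%N = ~~ is_top x.
Proof. by rewrite ltn_neqAle rank_le_rk andbT rank_eq_rk. Qed.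

Lemma bot_unique x y : is_bot x -> is_bot y -> x = y.
Proof. by move=> /forallP xb /forallP yb; apply: le_anti; rewrite xb yb. Qed.

Lemma top_unique x y : is_top x -> is_top y -> x = y.
Proof. by move=> /forallP xb /forallP yb; apply: le_anti; rewrite xb yb. Qed.

End Graded.

Section IdealEmbedding.
Context {disp disp' : Order.disp_t}.
Context {T : finPOrderType disp} {U : finPOrderType disp'}.
Implicit Types (D : {set T}) (f : T -> U).
Local Open Scope order_scope.

Definition down_closed D := forall x y, x \in D -> y <= x -> y \in D.

(** A lower set [D] of [T] is compared with a poset built on [D], and there is no
canonical value outside [D]; hence the function is only constrained on [D]. *)
Definition ideal_embedding D f : Prop :=
  [/\ down_closed D, {in D &, {mono f : x y / x <= y}}
    & forall x u, x \in D -> u <= f x -> exists2 y, y \in D & f y = u].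

Section Theory.
Variables (D : {set T}) (f : T -> U) (emb : ideal_embedding D f).

Lemma emb_inj : {in D &, injective f}.
Proof.
case: emb => _ fm _ x y xD yD fxy; apply: le_anti.
by rewrite -!fm ?fxy ?lexx.
Qed.

Lemma emb_lt : {in D &, {mono f : x y / x < y}}.
Proof.
case: emb => _ fm _ x y xD yD.
by rewrite !lt_neqAle fm // (inj_in_eq emb_inj).
Qed.

Lemma emb_below x : x \in D -> below (f x) = f @: below x.
Proof.
case: (emb) => dD fm fs xD; apply/setP => u; rewrite inE.
apply/idP/imsetP => [ux|[y]].
  have [y yD e] := fs x u xD (ltW ux); exists y => //.
  by rewrite inE -emb_lt // e.
rewrite inE => yx ->; rewrite emb_lt //; apply: dD xD _; exact: ltW.
Qed.

Lemma emb_below_inj x : x \in D -> {in below x &, injective f}.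
Proof.
case: (emb) => dD fm fs xD y z; rewrite !inE => /ltW yx /ltW zx.
by apply: emb_inj; apply: dD xD _.
Qed.

Lemma emb_rank x : x \in D -> rank (f x) = rank x.
Proof.
case: (emb) => dD _ _.
have [n] := ubnP (rank x); elim: n x => // n IH x; rewrite ltnS => xn xD.
rewrite rankE [RHS]rankE.
transitivity (\max_(u in below (f x)) (rank u).+1)%N.
  by apply: eq_bigl => u; rewrite inE.
rewrite emb_below // big_imset /=; last exact: emb_below_inj.
apply: eq_big => [y|y]; rewrite inE // => yx.
have yD : y \in D by apply: dD xD _; exact: ltW.
by congr _.+1; apply: IH yD; apply: leq_trans (lt_rank yx) xn.
Qed.

End Theory.
End IdealEmbedding.

(** * Partitions, lower sets and semisuspensions *)

Section Partitions.
Context {disp : Order.disp_t} {T : finPOrderType disp}.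
Implicit Types (x y z s t : T) (P : T -> {set T}).
Local Open Scope order_scope.

Lemma coatom_rank s : s \in coatoms T -> (rank s).+1 = rk T.
Proof. by rewrite inE => /eqP. Qed.

Lemma ideal_coatom_Ntop s x : s \in coatoms T -> x <= s -> ~~ is_top x.
Proof.
move=> sc xs; apply/negP => /top_rank xt.
by have := leq_rank xs; rewrite xt -(coatom_rank sc) ltnn.
Qed.

(** An elementwise form, convenient to move a partition along an isomorphism. *)
Lemma coatom_partitionP P : coatom_partition P <->
  [/\ forall x, ~~ is_top x -> exists2 s, s \in coatoms T & x \in P s,
      forall x s t, s \in coatoms T -> t \in coatoms T ->
        x \in P s -> x \in P t -> s = t,
      forall s, s \in coatoms T -> exists x, x \in P s
    & forall s x, s \in coatoms T -> x \in P s -> x <= s].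
Proof.
split=> [[Pinj /and3P[/eqP Pc /trivIsetP Pt P0] Ps]|[Pc Pt P0 Ps]].
  split=> [x xt|x s t sc tc xs xt|s sc|s x sc xP].
  - have : x \in cover [set P s | s in coatoms T] by rewrite Pc inE.
    by case/bigcupP => _ /imsetP[s sc ->] xs; exists s.
  - apply: Pinj => //; apply: contraTeq xs => PsPt.
    have := Pt (P s) (P t) (imset_f _ sc) (imset_f _ tc) PsPt.
    by rewrite disjoint_sym => /disjointFr/(_ xt) ->.
  - apply/set0Pn; apply: contraNneq P0 => <-; exact: imset_f.
  - by have /subsetP/(_ x xP) := Ps s sc; rewrite inE.
split.
- move=> s t sc tc Pst; have [x xs] := P0 s sc.
  by apply: (Pt x) => //; rewrite -Pst.
- apply/and3P; split.
  + apply/eqP/setP => x; rewrite inE; apply/bigcupP/idP.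
      by case=> _ /imsetP[s sc ->] /(Ps s x sc); apply: ideal_coatom_Ntop.
    by move/Pc => [s sc xs]; exists (P s) => //; apply: imset_f.
  + apply/trivIsetP => _ _ /imsetP[s sc ->] /imsetP[t tc ->] Pst.
    apply/pred0P => x /=; apply/negP => /andP[xs xt].
    by move: Pst; rewrite (Pt x s t) // eqxx.
  + apply/negP => /imsetP[s sc e]; have [x] := P0 s sc.
    by rewrite -e inE.
- by move=> s sc; apply/subsetP => x /(Ps s x sc); rewrite inE.
Qed.

End Partitions.

Section LowerTheory.
Context {disp : Order.disp_t} {T : finPOrderType disp} (A : {set T}).
Local Open Scope order_scope.

Lemma insub_lower (u : {x : T | x \in A}) : insub (val u) = Some u :> lower A.
Proof. exact: valK. Qed.

Lemma lower_top : is_top (None : lower A).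
Proof. by apply/forallP; case. Qed.

Lemma lower_is_top (u : lower A) : is_top u = (u == None).
Proof.
case: u => [u|]; last by rewrite lower_top.
by apply/negP => /forallP/(_ None) H; have : false := H.
Qed.

Lemma in_lower_boundary x : (x \in lower_boundary A) =
  (x \in A) && ((insub x : lower A) \in boundary (lower A)).
Proof.
apply/imsetP/andP => [[u ub ->]|[xA]].
  by split; [exact: valP|rewrite insub_lower; move: ub; rewrite [u \in _]in_set].
by rewrite (insubT (mem A) xA) => xb; exists (Sub x xA); rewrite // [_ \in finset _]in_set.
Qed.

Lemma lower_embedding : down_closed A ->
  ideal_embedding A (fun x => insub x : lower A).
Proof.
move=> dA; split=> // [x y xA yA|x [u|] xA].
- by rewrite (insubT (mem A) xA) (insubT (mem A) yA).
- by move=> _; exists (val u); [exact: valP|exact: insub_lower].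
- by rewrite (insubT (mem A) xA).
Qed.

End LowerTheory.

Lemma down_closure_closed {disp} {T : finPOrderType disp} (A : {set T}) :
  down_closed (down_closure A).
Proof.
move=> x y; rewrite !inE => /exists_inP[z zA xz] yx.
by apply/exists_inP; exists z => //; apply: le_trans xz.
Qed.

Lemma below_closed {disp} {T : finPOrderType disp} (x : T) :
  down_closed (below x).
Proof. by move=> y z; rewrite !inE => yx zy; apply: le_lt_trans yx. Qed.

Lemma lower_boundary_closed {disp} {T : finPOrderType disp} (A : {set T}) :
  down_closed A -> down_closed (lower_boundary A).
Proof.
move=> dA x y; rewrite !in_lower_boundary => /andP[xA xb] yx.
have yA := dA x y xA yx; rewrite yA /=; apply: down_closure_closed xb _.
by rewrite (insubT (mem A) xA) (insubT (mem A) yA).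
Qed.

Section SemisuspensionTheory.
Context {disp : Order.disp_t} {L : finPOrderType disp}.
Local Open Scope order_scope.
Local Notation Sg := (semisuspension L).

Lemma semisuspension_is_top (x : L) : is_top (Some x : Sg) = is_top x.
Proof.
apply/forallP/idP => [xt|xt].
  by apply/forallP => y; have := xt (Some y).
by case=> [y|] //=; have /forallP/(_ y) := xt.
Qed.

Lemma semisuspension_embedding :
  ideal_embedding [set x : L | ~~ is_top x] (fun x => Some x : Sg).
Proof.
split=> // [x y|x [u|]]; rewrite !inE.
- move=> xt yx; apply: contraNN xt => /forallP yt; apply/forallP => z.
  exact: le_trans (yt z) yx.
- move=> xt ux; exists u => //; rewrite inE; apply: contraNN xt => /forallP ut.
  by apply/forallP => z; apply: le_trans (ut z) ux.
- by move=> /negbTE xt; rewrite /Order.le /= xt.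
Qed.

Lemma semisuspension_below :
  below (None : Sg) = (fun x => Some x : Sg) @: boundary L.
Proof.
apply/setP => u; rewrite inE; apply/idP/imsetP => [|[x xb ->]].
  by case: u => [x|]; rewrite ?ltxx // lt_neqAle /= => xb; exists x.
by rewrite lt_neqAle.
Qed.

(** The added coatom is above some element, so the boundary is not empty: there is
an element [w] with only two larger ones, [z] and the maximum [t].  Then [t]
covers [z] both with and without the added coatom, and [z] has the same rank in
both posets. *)
Lemma rk_semisuspension : graded L -> graded Sg ->
  (None : Sg) \in coatoms Sg -> (2 <= rk Sg)%N -> rk Sg = rk L.
Proof.
move=> gL gS Nc r2; have [b bb b0] := graded_bot gS.
case: (gL) => _ [t tt] _; have tS : is_top (Some t : Sg) by rewrite semisuspension_is_top.
have : b < None.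
  have /forallP/(_ None) := bb; rewrite le_eqVlt => /predU1P[bN|//].
  by move: r2; rewrite -(coatom_rank Nc) -bN b0.
case: b {bb b0} => [b|]; rewrite ?ltxx // => /ltW bN.
have {b bN} [w /eqP w3] : exists w : L, #|[set z | w <= z]| == 3.
  move: bN; rewrite /Order.le /= inE => /exists_inP[w].
  by rewrite inE => w3 _; exists w.
have tw : w <= t by have /forallP := tt; apply.
have wt : w != t.
  apply/eqP => e; have s1 : [set z | w <= z] \subset [set t].
    apply/subsetP => z; rewrite !inE e => tz; rewrite eq_le tz andbT.
    by have /forallP := tt; apply.
  by have := subset_leq_card s1; rewrite w3 cards1.
have [z] : exists z, z \in [set z | w <= z] :\: [set w; t].
  apply/set0Pn; rewrite -card_gt0 cardsD w3.
  have -> : [set z | w <= z] :&: [set w; t] = [set w; t].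
    by apply/setIidPr/subsetP => z; rewrite !inE => /orP[]/eqP->.
  by rewrite cards2 wt.
rewrite !inE negb_or => /andP[/andP[zw zt] wz].
have upw v : w <= v -> v \in [set w; z; t].
  have s3 : [set w; z; t] \subset [set z | w <= z].
    by apply/subsetP => u; rewrite !inE -orbA => /or3P[]/eqP->.
  have := subset_leqif_cards s3; rewrite w3 => -[_].
  have -> : #|[set w; z; t]| = 3.
    by rewrite setUC cardsU1 !inE cards2 (eq_sym w z) zw (eq_sym t) (negbTE wt)
               (eq_sym t) (negbTE zt).
  by rewrite eqxx => /esym/eqP -> wv; rewrite inE.
have zlt : z < t by rewrite lt_neqAle zt; have /forallP := tt; apply.
(* the elements above z are those above w, without w *)
have upz v : z <= v -> v = z \/ v = t.
  move=> zv; have := upw v (le_trans wz zv); rewrite !inE -orbA => /or3P[]/eqP e; auto.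
  by left; apply: le_anti; rewrite zv e wz.
have zNt : ~~ is_top z by apply/negP => /top_unique /(_ tt) e; rewrite e eqxx in zt.
have rz : rank (Some z : Sg) = rank z by apply: (emb_rank semisuspension_embedding); rewrite inE.
have cL : covered_by z t.
  rewrite /covered_by zlt; apply/forallP => v; apply/negP => /andP[zv vt].
  by case: (upz v (ltW zv)) => e; rewrite e ltxx in zv vt.
have cS : covered_by (Some z : Sg) (Some t).
  rewrite /covered_by [X in X && _]lt_neqAle; apply/andP; split.
    by apply/andP; split; [|exact: (ltW zlt)].
  apply/forallP => -[v|]; apply/negP => /andP[zv vt].
    case: (upz v (ltW zv)) => e; rewrite e in zv vt; first by rewrite ltxx in zv.
    by rewrite ltxx in vt.
  move: (ltW zv); rewrite /Order.le /= inE => /exists_inP[y].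
  rewrite inE => /eqP y3 zy.
  have : [set v | y <= v] \subset [set z; t].
    apply/subsetP => v; rewrite !inE => yv.
    by case: (upz v (le_trans zy yv)) => ->; rewrite eqxx ?orbT.
  by move=> /subset_leq_card; rewrite y3 cards2; case: (_ != _).
case: gL => _ _ /(_ _ _ cL); rewrite (top_rank tt) => ->.
by case: gS => _ _ /(_ _ _ cS); rewrite (top_rank tS) => ->; rewrite rz.
Qed.

End SemisuspensionTheory.

(** * Invariance under isomorphism *)

Section PosetIso.
Context {disp : Order.disp_t}.
Implicit Types (T U : finPOrderType disp).
Local Open Scope order_scope.

Definition poset_iso T U (f : T -> U) : Prop :=
  {mono f : x y / x <= y} /\ forall u, exists x, f x = u.

Section Transfer.
Variables (T U : finPOrderType disp) (f : T -> U) (isof : poset_iso f).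

Lemma iso_embedding : ideal_embedding [set: T] f.
Proof.
case: isof => fm fs; split=> [x y|x y|x u] *; rewrite ?inE //.
by have [y fy] := fs u; exists y; rewrite ?inE.
Qed.

Lemma iso_inj : injective f.
Proof. by move=> x y; apply: (emb_inj iso_embedding); rewrite inE. Qed.

Lemma iso_imset : f @: [set: T] = [set: U].
Proof.
by apply/setP => u; rewrite inE; apply/imsetP; have [x <-] := isof.2 u; exists x.
Qed.

Lemma iso_bij : bijective f.
Proof.
apply: inj_card_bij iso_inj _.
by have := leq_imset_card f [set: T]; rewrite iso_imset !cardsT.
Qed.

Lemma iso_rank x : rank (f x) = rank x.
Proof. by apply: (emb_rank iso_embedding); rewrite inE. Qed.

Lemma iso_lt x y : (f x < f y) = (x < y).
Proof. by apply: (emb_lt iso_embedding); rewrite inE. Qed.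

Lemma iso_forall (p : pred U) : [forall u, p u] = [forall x, p (f x)].
Proof.
apply/forallP/forallP => pf x //; have [y <-] := isof.2 x; exact: pf.
Qed.

Lemma iso_bot x : is_bot (f x) = is_bot x.
Proof. by rewrite /is_bot iso_forall; apply: eq_forallb => y; rewrite isof.1. Qed.

Lemma iso_top x : is_top (f x) = is_top x.
Proof. by rewrite /is_top iso_forall; apply: eq_forallb => y; rewrite isof.1. Qed.

Lemma iso_covered x y : covered_by (f x) (f y) = covered_by x y.
Proof.
rewrite /covered_by iso_lt iso_forall; congr andb.
by apply: eq_forallb => z; rewrite !iso_lt.
Qed.

Lemma iso_rk : rk U = rk T.
Proof.
rewrite /rk (reindex f) /=; last exact/onW_bij/iso_bij.
by apply: eq_bigr => x _; rewrite iso_rank.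
Qed.

Lemma iso_coatom x : (f x \in coatoms U) = (x \in coatoms T).
Proof. by rewrite !inE iso_rank iso_rk. Qed.

Lemma iso_card (A : {set U}) : #|f @^-1: A| = #|A|.
Proof. by apply: on_card_preimset; apply/onW_bij/iso_bij. Qed.

Lemma iso_balanced x y : balanced (f x) (f y) -> balanced x y.
Proof.
suff E o : #|[set z | (x <= z <= y) && (odd (rank z) == o)]|
         = #|[set z | (f x <= z <= f y) && (odd (rank z) == o)]|.
  have Eb (V : finPOrderType disp) (v w : V) : balanced v w <->
     #|[set z | (v <= z <= w) && (odd (rank z) == false)]|
   = #|[set z | (v <= z <= w) && (odd (rank z) == true)]|.
    rewrite /balanced; suff e o : [set z | (v <= z <= w) && (odd (rank z) == o)]
       = [set z | (v <= z <= w) && (if o then odd (rank z) else ~~ odd (rank z))].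
      by rewrite !e.
    by apply/setP => z; rewrite !inE; case: o; case: odd.
  by rewrite !Eb !E.
rewrite -iso_card; congr #|pred_of_set _|; apply/setP => z.
by rewrite !inE !isof.1 iso_rank.
Qed.

Lemma iso_graded : graded U -> graded T.
Proof.
case=> [[b bb] [t tt] gU]; split.
- by have [x xb] := isof.2 b; exists x; rewrite -iso_bot xb.
- by have [x xt] := isof.2 t; exists x; rewrite -iso_top xt.
- by move=> x y xy; rewrite -!iso_rank; apply: gU; rewrite iso_covered.
Qed.

Lemma iso_eulerian : eulerian U -> eulerian T.
Proof.
case=> gU eU; split; first exact: iso_graded.
by move=> x y xy; apply/iso_balanced/eU; rewrite iso_lt.
Qed.

Lemma iso_ideal x : f @^-1: ideal (f x) = ideal x.
Proof. by apply/setP => y; rewrite !inE isof.1. Qed.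

Lemma iso_set1 x : f @^-1: [set f x] = [set x].
Proof. by apply/setP => y; rewrite !inE (inj_eq iso_inj). Qed.

Lemma iso_preim_inj (A B : {set U}) : f @^-1: A = f @^-1: B -> A = B.
Proof.
move=> /setP AB; apply/setP => u; have [x <-] := isof.2 u.
by have := AB x; rewrite !inE.
Qed.

Lemma iso_down_closure (A : {set U}) :
  down_closure (f @^-1: A) = f @^-1: down_closure A.
Proof.
apply/setP => y; rewrite !inE; apply/exists_inP/exists_inP => -[x xA yx].
  by exists (f x); rewrite ?isof.1 //; rewrite inE in xA.
by have [z zx] := isof.2 x; exists z; rewrite ?inE -?isof.1 zx.
Qed.

Lemma iso_boundary x : (f x \in boundary U) = (x \in boundary T).
Proof.
rewrite /boundary; suff -> : [set y : T | #|[set z | y <= z]| == 3]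
    = f @^-1: [set y : U | #|[set z | y <= z]| == 3].
  by rewrite iso_down_closure [RHS]inE.
apply/setP => y; rewrite !inE -[in RHS]iso_card; congr (#|pred_of_set _| == _).
by apply/setP => z; rewrite !inE isof.1.
Qed.

Lemma iso_coatom_partition (P : U -> {set U}) :
  coatom_partition P -> coatom_partition (fun x => f @^-1: P (f x)).
Proof.
move=> /coatom_partitionP[Pc Pt P0 Ps]; apply/coatom_partitionP; split.
- move=> x; rewrite -iso_top => /Pc[s]; have [t <-] := isof.2 s.
  by rewrite iso_coatom => tc xt; exists t; rewrite // inE.
- move=> x s t; rewrite -!iso_coatom => sc tc; rewrite !inE => xs xt.
  by apply: iso_inj; apply: (Pt (f x)).
- move=> s; rewrite -iso_coatom => /P0[u]; have [x <-] := isof.2 u.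
  by exists x; rewrite inE.
- by move=> s x; rewrite -iso_coatom -isof.1 => sc; rewrite inE; apply: Ps.
Qed.

Lemma iso_near_eulerian : near_eulerian U -> near_eulerian T.
Proof.
case=> gU [Q [tau [g [eQ tc gm gs]]]]; split; first exact: iso_graded.
exists Q, tau, (g \o f); split=> // [x y|]; first by rewrite /= gm isof.1.
by rewrite imset_comp iso_imset.
Qed.

End Transfer.

Section LowerMap.
Variables (T U : finPOrderType disp) (f : T -> U) (A : {set T}) (B : {set U}).

(** Defined with [insub], so that it needs no proof that [f] maps [A] to [B]. *)
Definition lower_map (u : lower A) : lower B :=
  if u is Some x then insub (f (val x)) else None.

Hypothesis fm : {in A &, {mono f : x y / x <= y}}.
Hypothesis fAB : B = f @: A.

Lemma lower_map_iso : poset_iso lower_map.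
Proof.
have fB x : x \in A -> f x \in B by move=> xA; rewrite fAB imset_f.
split=> [[x|] [y|]|[u|]].
- by rewrite /lower_map (insubT (mem B) (fB _ (valP x))) (insubT (mem B) (fB _ (valP y)))
    /Order.le /= fm ?(valP x) ?(valP y).
- by rewrite /lower_map (insubT (mem B) (fB _ (valP x))).
- by rewrite /lower_map (insubT (mem B) (fB _ (valP y))).
- by [].
- have uB : val u \in B := valP u.
  have [x xA ux] : exists2 x, x \in A & val u = f x.
    by apply/imsetP; move: (val u) uB => v; rewrite fAB.
  by exists (insub x); rewrite (insubT (mem A) xA) /= -ux insub_lower.
- by exists None.
Qed.

End LowerMap.

Section LowerTransfer.
Variables (T U : finPOrderType disp) (f : T -> U) (isof : poset_iso f).
Variable (B : {set U}).

Lemma lower_preim_iso : poset_iso (@lower_map _ _ f (f @^-1: B) B).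
Proof.
apply: lower_map_iso => [x y _ _|]; first exact: isof.1.
apply/setP => u; have [x <-] := isof.2 u.
by apply/idP/imsetP => [xB|[y]]; [exists x; rewrite ?inE|rewrite inE => yB ->].
Qed.

Lemma iso_lower_boundary :
  lower_boundary (f @^-1: B) = f @^-1: lower_boundary B.
Proof.
apply/setP => x; rewrite [in RHS]inE !in_lower_boundary [in LHS]inE.
case xB: (f x \in B) => //=; rewrite -(iso_boundary lower_preim_iso).
have xA : x \in f @^-1: B by rewrite inE.
by rewrite (insubT (mem (f @^-1: B)) xA).
Qed.

End LowerTransfer.

Section SemisuspensionMap.
Variables (T U : finPOrderType disp) (f : T -> U) (isof : poset_iso f).

Definition semisuspension_map (x : semisuspension T) : semisuspension U :=
  if x is Some x then Some (f x) else None.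

Lemma semisuspension_map_iso : poset_iso semisuspension_map.
Proof.
split=> [[x|] [y|]|[u|]].
- exact: isof.1.
- exact: iso_boundary.
- exact: iso_top.
- by [].
- by have [x <-] := isof.2 u; exists (Some x).
- by exists None.
Qed.

End SemisuspensionMap.

(** Inversion for a variable coatom; it then applies to the added coatom [None] of
a semisuspension, where a direct inversion would need to be dependent. *)
Lemma S_partitionable_fromP T (s1 : T) : S_partitionable_from s1 ->
  exists (P : T -> {set T}) (st : T),
  [/\ [/\ eulerian T, (2 <= rk T)%N & coatom_partition P],
      [/\ s1 \in coatoms T, P s1 = ideal s1,
          {in coatoms T, forall s, P s = ideal s -> s = s1},
          S_partitionable (lower (P s1 :\ s1))
        & (rk (lower (P s1 :\ s1))).+1 = rk T],
      [/\ st \in coatoms T, P st = [set st]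
        & {in coatoms T, forall s, P s = [set s] -> s = st}],
      {in coatoms T, forall s, s != s1 -> s != st ->
        let G := down_closure (P s :\ s) in
        [/\ near_eulerian (lower G), (rk (lower G)).+1 = rk T,
            G = (P s :\ s) :|: lower_boundary G
          & [disjoint P s :\ s & lower_boundary G]]}
    & {in coatoms T, forall s, s != s1 -> s != st ->
        S_partitionable_from
          (None : semisuspension (lower (down_closure (P s :\ s))))}].
Proof. by case=> {}T P {}s1 st *; exists P, st. Qed.

Lemma S_partitionableP T : S_partitionable T ->
  eulerian T /\ rk T = 1%N \/ exists s1 : T, S_partitionable_from s1.
Proof. by case=> {}T => [|s1] *; [left|right; exists s1]. Qed.

Lemma S_partitionable_eulerian T : S_partitionable T -> eulerian T.
Proof. by case/S_partitionableP=> [[]|[s1 /S_partitionable_fromP[P [st [[]]]]]]. Qed.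

Lemma rk_semisuspension_from (L : finPOrderType disp) : graded L ->
  S_partitionable_from (None : semisuspension L) -> rk (semisuspension L) = rk L.
Proof.
move=> gL /S_partitionable_fromP[P [st [[[gS _] r2 _] [Nc _ _ _ _] _ _ _]]].
exact: rk_semisuspension.
Qed.

(** The boundary of a lower set occurs both as a lower set of the given poset and
as the part below the added coatom of a semisuspension; the definition provides
an S-partition in the second form, and the recursion needs the first.  The
classes are pulled back as preimages, which commute with all the operations
involved. *)
Lemma S_partitionable_iso T U (f : T -> U) : poset_iso f ->
  (S_partitionable U -> S_partitionable T) /\
  (forall s1, S_partitionable_from (f s1) -> S_partitionable_from s1).
Proof.
have [n] := ubnP (rk U); elim: n T U f => // n IH T U f rU isof.
suff from s1 : S_partitionable_from (f s1) -> S_partitionable_from s1.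
  split=> // /S_partitionableP[[eU r1]|[s]].
    by apply: S_partitionable_rank1; [exact: iso_eulerian isof eU|rewrite -(iso_rk isof)].
  by have [s1 <-] := isof.2 s => /from; apply: S_partitionable_rank_ge2.
case/S_partitionable_fromP=> P [st [[eU r2 cP] [s1c Ps1 u1 S1 rk1] [stc Pst ut] hN hS]].
have [t et] := isof.2 st; rewrite -{}et {st} in stc Pst ut hN hS.
pose P' x := f @^-1: P (f x).
have P'D x : P' x :\ x = f @^-1: (P (f x) :\ f x).
  by apply/setP => y; rewrite !inE (inj_eq (iso_inj isof)).
have neq x y : x != y -> f x != f y by rewrite (inj_eq (iso_inj isof)).
have rlt (V : finPOrderType disp) : (rk V).+1 = rk U -> (rk V < n)%N.
  by move=> e; move: rU; rewrite -e ltnS.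
apply: (@S_partition _ _ P' s1 t).
- exact: iso_eulerian isof eU.
- by rewrite -(iso_rk isof).
- exact: iso_coatom_partition.
- by rewrite -(iso_coatom isof).
- by rewrite /P' Ps1 iso_ideal.
- move=> s; rewrite -(iso_coatom isof) => sc; rewrite /P' -(iso_ideal isof).
  by move/(iso_preim_inj isof)/(u1 _ sc)/(iso_inj isof).
- rewrite P'D; apply: (IH _ _ _ _ (lower_preim_iso isof _)).1 => //; exact: rlt.
- by rewrite P'D -(iso_rk isof) -rk1 (iso_rk (lower_preim_iso isof _)).
- by rewrite -(iso_coatom isof).
- by rewrite /P' Pst iso_set1.
- move=> s; rewrite -(iso_coatom isof) => sc; rewrite /P' -(iso_set1 isof).
  by move/(iso_preim_inj isof)/(ut _ sc)/(iso_inj isof).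
- move=> s; rewrite -(iso_coatom isof) => sc /neq s1' /neq st'.
  have [nG rG eG dG] := hN _ sc s1' st'.
  rewrite P'D iso_down_closure // iso_lower_boundary //; split.
  + exact: iso_near_eulerian (lower_preim_iso isof _) nG.
  + by rewrite -(iso_rk isof) -rG (iso_rk (lower_preim_iso isof _)).
  + by rewrite -preimsetU -eG.
  + rewrite -setI_eq0 -preimsetI; move: dG; rewrite -setI_eq0 => /eqP ->.
    by rewrite preimset0.
- move=> s; rewrite -(iso_coatom isof) => sc /neq s1' /neq st'.
  have [nG rG _ _] := hN _ sc s1' st'; have SG := hS _ sc s1' st'.
  rewrite P'D iso_down_closure //.
  have isoS := semisuspension_map_iso (lower_preim_iso isof (down_closure (P (f s) :\ f s))).
  have [|_ fromS] := IH _ _ _ _ isoS; last exact: fromS None SG.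
  by apply: rlt; rewrite rk_semisuspension_from //; case: nG.
Qed.

End PosetIso.

(** * Flag polynomials as sums of weights *)

Section ChainWeight.
Context (R : nzRingType) (x y : R).

(** For [rank z <= n], the sum over the chains without the minimum whose
maximum is [z] (the empty chain if [z] is the minimum) of the word of length [n]
with letter [y] at the ranks of the chain and [x] elsewhere; see [chain_sum].
The recursive form shows that only the elements below [z] matter. *)
Fixpoint weight {disp} {T : finPOrderType disp} (n : nat) (z : T) : R :=
  match n with
  | 0 => (rank z == 0%N)%:R
  | n'.+1 => if rank z == n'.+1 then (\sum_(u in below z) weight n' u) * y
             else weight n' z * x
  end.

Lemma weight_le disp (T : finPOrderType disp) n (z : T) :
  (rank z <= n)%N -> weight n.+1 z = weight n z * x.
Proof. by move=> zn /=; rewrite ltn_eqF. Qed.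

Lemma weight_eq disp (T : finPOrderType disp) n (z : T) :
  rank z = n.+1 -> weight n.+1 z = (\sum_(u in below z) weight n u) * y.
Proof. by move=> /= ->; rewrite eqxx. Qed.

Lemma weight_bot disp (T : finPOrderType disp) n (z : T) :
  is_bot z -> weight n z = x ^+ n.
Proof.
move=> /bot_rank0 z0; elim: n => [|n IH]; first by rewrite /= z0.
by rewrite weight_le ?z0 // IH exprSr.
Qed.

Lemma emb_weight disp disp' (T : finPOrderType disp) (U : finPOrderType disp')
    (D : {set T}) (f : T -> U) n (z : T) :
  ideal_embedding D f -> z \in D -> weight n (f z) = weight n z.
Proof.
move=> emb; have [dD _ _] := emb; elim: n z => [|n IH] z zD /=.
  by rewrite (emb_rank emb).
rewrite (emb_rank emb) // IH //; case: ifP => // _; congr (_ * _).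
rewrite (emb_below emb) // big_imset /=; last exact: (emb_below_inj emb zD).
apply: eq_bigr => u; rewrite inE => uz; apply: IH.
by apply: dD zD _; apply: ltW.
Qed.

Arguments weight : simpl never.

Section ChainSum.
Context {disp : Order.disp_t} {T : finPOrderType disp} (gT : graded T).
Implicit Types (C D : {set T}) (z u : T).

Definition ranked_chains n D : {set {set T}} :=
  [set C | chain C & [forall z in C, (z \in D) && (0 < rank z <= n)%N]].

Lemma ranked_chainsP n D C :
  reflect (chain C /\ forall z, z \in C -> [/\ z \in D, 0 < rank z & rank z <= n])%N
          (C \in ranked_chains n D).
Proof.
rewrite inE; apply: (iffP andP) => -[chC CD]; split=> //.
  by move=> z zC; have /forall_inP/(_ z zC)/and3P := CD.
by apply/forall_inP => z zC; apply/and3P/CD.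
Qed.

Lemma ranked_chains_setU1 n D z C : down_closed D -> z \in D -> rank z = n.+1 ->
  (C \in ranked_chains n (below z)) =
  (z |: C \in ranked_chains n.+1 D) && (z \notin C).
Proof.
move=> dD zD rz; apply/ranked_chainsP/andP => [[chC CD]|[/ranked_chainsP[chC CD] zC]].
  have zC : z \notin C by apply/negP => /CD[]; rewrite inE ltxx.
  split=> //; apply/ranked_chainsP; split.
    apply/chainP => u v /setU1P[->|uC] /setU1P[->|vC].
    - exact: comparablexx.
    - by rewrite comparable_sym; apply: lt_comparable; have [] := CD v vC; rewrite inE.
    - by apply: lt_comparable; have [] := CD u uC; rewrite inE.
    - by move/chainP: chC; apply.
  move=> u /setU1P[->|/CD[]]; first by rewrite rz.
  by rewrite inE => /ltW uz u0 un; split=> //; [exact: dD uz|exact: leqW].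
have zzC : z \in z |: C by rewrite setU11.
split=> [|u uC]; first by apply: chain_sub chC; apply: subsetU1.
have uzC : u \in z |: C by rewrite setU1r.
have [uD u0] := CD u uzC; rewrite leq_eqVlt => /predU1P[ru|ru].
  have uz : u = z by apply: chain_rank_inj chC _ _ _; rewrite ?rz.
  by rewrite -uz uC in zC.
by split; rewrite // inE; apply: chain_rank_lt chC _ _ _; rewrite ?rz.
Qed.

(** A chain has at most one element [z] of rank [n.+1], and if it has one, the
others form a chain below [z].  The hypotheses on [w] are those that this
argument uses; they hold for the words of flag polynomials, and for the signs of
chains at [x = 1], [y = -1]. *)
Lemma chain_sum (w : nat -> {set T} -> R) :
  w 0%N set0 = 1 ->
  (forall n C, C \in ranked_chains n [set: T] -> w n.+1 C = w n C * x) ->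
  (forall n C z, C \in ranked_chains n [set: T] -> rank z = n.+1 ->
     w n.+1 (z |: C) = w n C * y) ->
  forall n D b, down_closed D -> b \in D -> is_bot b ->
  \sum_(C in ranked_chains n D) w n C = \sum_(z in D | (rank z <= n)%N) weight n z.
Proof.
move=> w0 wx wy; elim=> [|n IH] D b dD bD bb.
  rewrite (big_pred1 set0); last first.
    move=> C; apply/ranked_chainsP/eqP => [[_ CD]|->].
      apply/setP => z; rewrite inE; apply/negP => /CD[_].
      by rewrite lt0n => /negbTE z0; rewrite leqn0 z0.
    by split=> [|z]; rewrite ?inE //; apply/chainP => z; rewrite inE.
  rewrite w0 (big_pred1 b) /=; first by rewrite weight_bot ?expr0.
  move=> z; rewrite leqn0 rank_eq0 //; apply/andP/eqP => [[_ zb]|->//].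
  exact: bot_unique zb bb.
have subT m C E : C \in ranked_chains m E -> C \in ranked_chains m [set: T].
  move=> /ranked_chainsP[chC CE]; apply/ranked_chainsP; split=> // z /CE[_ ? ?].
  by rewrite inE.
rewrite (bigID (fun C => [exists z in C, rank z == n.+1])) /= addrC.
rewrite [RHS](bigID (fun z => (rank z <= n)%N)) /=; congr (_ + _).
  rewrite (eq_bigl (mem (ranked_chains n D))); last first.
    move=> C; apply/andP/ranked_chainsP => [[/ranked_chainsP[chC CD] Cn]|[chC CD]].
      split=> // z zC; have [zD z0 zn] := CD z zC; split=> //.
      move: zn; rewrite leq_eqVlt => /orP[zn|//].
      by case/exists_inP: Cn; exists z.
    split; last by apply/exists_inP => -[z /CD[_ _ zn] /eqP e]; rewrite e ltnn in zn.
    by apply/ranked_chainsP; split=> // z /CD[? ? ?]; split=> //; apply: leqW.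
  rewrite (eq_bigr (fun C => w n C * x)); last by move=> C /subT /wx.
  rewrite -mulr_suml (IH D b) // mulr_suml; apply: eq_big => z.
    by rewrite -andbA; congr andb; apply/esym/andb_idl => /leqW.
  by case/andP=> _ zn; rewrite weight_le.
(* sort the chains by their element of rank n.+1; the default b never occurs *)
rewrite (partition_big (fun C => odflt b [pick z in C | rank z == n.+1])
           (fun z => (z \in D) && (rank z == n.+1))) /=; last first.
  move=> C /andP[/ranked_chainsP[chC CD] /exists_inP[z zC zn]].
  case: pickP => [u /andP[uC ->]|/(_ z)] /=; last by rewrite [z \in C]zC zn.
  by rewrite andbT; have [] := CD u uC.
apply: eq_big => z.
  by rewrite -andbA -ltnNge eqn_leq.
case/andP=> zD /eqP rz; rewrite weight_eq //.
rewrite (reindex_onto (fun C => z |: C) (fun C => C :\ z)) /=; last first.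
  move=> C /andP[/andP[_ /exists_inP[v vC vn]] /eqP].
  case: pickP => [u /andP[uC _] /= <-|/(_ v)]; first by rewrite setD1K.
  by rewrite [v \in C]vC vn.
rewrite (eq_bigl (mem (ranked_chains n (below z)))); last first.
  move=> C /=; rewrite (ranked_chains_setU1 _ dD) //.
  have -> : ((z |: C) :\ z == C) = (z \notin C).
    apply/eqP/idP => [<-|zC]; first by rewrite !inE eqxx.
    exact: setU1K.
  case zC: (z \in C); rewrite ?andbF // !andbT -andbA.
  apply: andb_idr => zCr.
  have zzC : z \in z |: C by rewrite setU11.
  have [chC _] := ranked_chainsP _ _ _ zCr.
  apply/andP; split; first by apply/exists_inP; exists z; rewrite ?rz.
  case: pickP => [u /andP[uC /eqP un]|/(_ z)] /=; last by rewrite zzC rz eqxx.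
  by apply/eqP; apply: chain_rank_inj chC _ _ _; rewrite ?rz.
rewrite (eq_bigr (fun C => w n C * y)); last by move=> C /subT Cn; apply: wy.
rewrite -mulr_suml (IH (below z) b) //.
- congr (_ * _); apply: eq_bigl => u; rewrite inE; apply: andb_idr => /lt_rank.
  by rewrite rz.
- exact: below_closed.
- rewrite inE lt_neqAle (forallP bb) andbT; apply/eqP => e.
  by move: rz; rewrite -e bot_rank0.
Qed.

End ChainSum.
End ChainWeight.

Section FlagPoly.
Context {disp : Order.disp_t} {T : finPOrderType disp}.
Hypotheses (gT : graded T) (rT : (0 < rk T)%N).
Implicit Types (C : {set T}) (z u : T).
Local Notation d := (rk T).-1.

Lemma rank_le_pred z : (rank z <= d)%N = ~~ is_top z.
Proof. by rewrite -ltnS prednK // rank_lt_rk. Qed.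

Lemma proper_rank z : (~~ is_bot z && ~~ is_top z) = (0 < rank z <= d)%N.
Proof. by rewrite rank_le_pred lt0n rank_eq0. Qed.

Lemma chain_sum_setT (R : nzRingType) (x y : R) (w : nat -> {set T} -> R) :
  w 0%N set0 = 1 ->
  (forall n C, C \in ranked_chains n [set: T] -> w n.+1 C = w n C * x) ->
  (forall n C z, C \in ranked_chains n [set: T] -> rank z = n.+1 ->
     w n.+1 (z |: C) = w n C * y) ->
  \sum_(C in ranked_chains d [set: T]) w d C = \sum_(z : T | ~~ is_top z) weight x y d z.
Proof.
move=> w0 wx wy; have [b bb _] := graded_bot gT.
rewrite (@chain_sum _ x y _ _ gT w w0 wx wy d [set: T] b) // => [|u v _ _]; rewrite ?inE //.
by apply: eq_bigl => z; rewrite inE rank_le_pred.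
Qed.

Lemma sum_flag_f (R : nzRingType) (x y : R) :
  \sum_(K : {set 'I_d}) (\prod_(i < d) (if i \in K then y else x)) *+ flag_f K
  = \sum_(z : T | ~~ is_top z) weight x y d z.
Proof.
pose w n C : R := \prod_(i < n) (if [exists z in C, rank z == i.+1] then y else x).
rewrite -(chain_sum_setT (w := w)); first last.
- move=> n C z /ranked_chainsP[chC Cn] rz; rewrite /w big_ord_recr /=; congr (_ * _).
    apply: eq_bigr => i _; congr (if _ then _ else _).
    apply/exists_inP/exists_inP => -[u uC ru]; exists u => //.
      by case/setU1P: uC ru => [->|//]; rewrite rz eqSS gtn_eqF.
    by rewrite setU1r.
  by case: exists_inP => // -[]; exists z; rewrite ?setU11 ?rz.
- move=> n C /ranked_chainsP[chC Cn]; rewrite /w big_ord_recr /=; congr (_ * _).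
  by case: exists_inP => // -[u /Cn[_ _ un] /eqP ru]; rewrite ru ltnn in un.
- by rewrite /w big_ord0.
transitivity (\sum_(K : {set 'I_d}) \sum_(C in ranked_chains d [set: T] |
     K == [set i : 'I_d | [exists z in C, rank z == i.+1]]) w d C); last first.
  rewrite (exchange_big_dep (mem (ranked_chains d [set: T]))) /=; last by move=> K C _ /andP[].
  by apply: eq_bigr => C CR; rewrite CR big_pred1_eq.
apply: eq_bigr => K _; rewrite /flag_f.
transitivity (\sum_(C in ranked_chains d [set: T] |
     K == [set i : 'I_d | [exists z in C, rank z == i.+1]]) 
     (\prod_(i < d) (if i \in K then y else x))); last first.
  apply: eq_bigr => C /andP[_ /eqP ->]; apply: eq_bigr => i _; by rewrite inE.
rewrite sumr_const -cardsE; congr (_ *+ _); apply: eq_card => C; rewrite !inE.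
apply/and3P/andP => [[chC CK KC]|[/ranked_chainsP[chC CT] /eqP ->]].
  split.
    apply/ranked_chainsP; split=> // z zC; rewrite inE.
    by have /forall_inP/(_ z zC)/exists_inP[i iK /eqP ->] := CK; rewrite ltn_ord.
  apply/eqP/setP => i; rewrite inE; apply/idP/idP => [iK|/exists_inP[z zC /eqP zi]].
    by have /forall_inP := KC; apply.
  have /forall_inP/(_ z zC)/exists_inP[j jK] := CK.
  by rewrite zi eqSS => /eqP/val_inj ->.
split=> //.
  apply/forall_inP => z zC; have [_ z0 zd] := CT z zC.
  have zd' : ((rank z).-1 < d)%N by rewrite prednK.
  apply/exists_inP; exists (Ordinal zd'); rewrite /= ?prednK // inE /=.
  by apply/exists_inP; exists z; rewrite ?prednK.
by apply/forall_inP => i; rewrite inE.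
Qed.

(** A semi-Eulerian poset of rank d + 1 is Eulerian exactly if this sum is equal to
(-1)^d. *)
Definition sgn_sum : int := \sum_(z : T | ~~ is_top z) sgn z.

Lemma euler_char_weight :
  euler_char T = 1 - \sum_(z : T | ~~ is_top z) weight (1 : int) (- 1) d z.
Proof.
rewrite -(chain_sum_setT (w := fun _ C => (-1) ^+ #|C|)); first last.
- move=> n C z /ranked_chainsP[_ Cn] rz.
  rewrite cardsU1; have -> : z \notin C by apply/negP => /Cn[_ _]; rewrite rz ltnn.
  by rewrite exprS mulrC.
- by move=> n C _; rewrite mulr1.
- by rewrite cards0 expr0.
rewrite (bigD1 set0) /=; last first.
  by apply/ranked_chainsP; split=> [|z]; rewrite ?inE //; apply/chainP => z; rewrite inE.
rewrite cards0 expr0 opprD addrA subrr add0r -sumrN /euler_char.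
apply: eq_big => C.
  apply/and3P/andP => [[chC C0 CP]|[/ranked_chainsP[chC CT] C0]]; split=> //.
    apply/ranked_chainsP; split=> // z zC; have := forall_inP CP z zC.
    by rewrite inE proper_rank => /andP[].
  by apply/forall_inP => z zC; rewrite proper_rank; have [_ -> ->] := CT z zC.
case/and3P=> _ C0 _; case E: #|C| => [|n].
  by move/eqP: E; rewrite cards_eq0 (negbTE C0).
by rewrite exprS mulN1r opprK.
Qed.

Lemma flag_poly_weight (R : nzRingType) (x y : R) :
  flag_poly T x y = \sum_(z : T | ~~ is_top z) weight x y d z
    + (if (0 < d)%N then x ^+ d.-1 * y else 0)
      *~ (sphere_euler_char d - euler_char T).
Proof.
rewrite -sum_flag_f /flag_poly; set corr := _ - _.
pose top_rank_set := [set i : 'I_d | i.+1 == d].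
transitivity (\sum_(K : {set 'I_d})
    ((\prod_(i < d) (if i \in K then y else x)) *+ flag_f K
     + if K == top_rank_set then (if (0 < d)%N then
       \prod_(i < d) (if i \in K then y else x) else 0) *~ corr else 0)).
  apply: eq_bigr => K _; rewrite /flag_f' -/top_rank_set.
  case: (posnP d) => /= [_|_]; first by rewrite mul0rz if_same addr0.
  case: ifP => _; last by rewrite addr0.
  by rewrite -addrA mulrzDr.
rewrite big_split /=; congr (_ + _).
rewrite -big_mkcond big_pred1_eq; congr (_ *~ _).
case: posnP => // d0; rewrite /top_rank_set.
case: d d0 => // n _ /=; rewrite big_ord_recr /= inE eqxx; congr (_ * _).
rewrite -[in RHS](card_ord n) -prodr_const; apply: eq_bigr => i _.
by rewrite inE /= eqSS ltn_eqF.
Qed.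
End FlagPoly.

(** * The correction term of a semi-Eulerian poset *)

Section SignSums.
Context {disp : Order.disp_t} {T : finPOrderType disp}.
Implicit Types (u z : T).
Local Open Scope order_scope.

Lemma sum_sgn_below u z : u < z -> balanced u z ->
  (\sum_(v | (u <= v < z)%O) sgn v = - sgn z)%R.
Proof.
move=> uz /balanced_sum; rewrite (bigD1 z) /= ?lexx ?(ltW uz) // => /eqP.
rewrite addrC addr_eq0 => /eqP <-; apply: eq_bigl => v.
by rewrite (lt_neqAle v) -andbA; congr andb; rewrite andbC.
Qed.

End SignSums.

Section SemiEulerian.
Context {disp : Order.disp_t} {T : finPOrderType disp}.
Hypotheses (sT : semi_eulerian T) (rT : (0 < rk T)%N).
Implicit Types (u z : T).
Local Notation d := (rk T).-1.

Let gT : graded T := sT.1.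

Lemma semi_balanced u z : (u < z)%O -> ~~ is_bot u || ~~ is_top z -> balanced u z.
Proof. by move=> uz; rewrite -negb_and; apply: sT.2. Qed.

(** By Hall's formula this weight is the value of the Moebius function on the
interval from the minimum to [z], which is Eulerian. *)
Lemma weight_sgn n z : ~~ is_top z -> (rank z <= n)%N ->
  weight (1 : int) (- 1) n z = sgn z.
Proof.
elim: n z => [|n IH] z zt; rewrite ?leqn0 => zn.
  by rewrite /weight /sgn zn (eqP zn).
move: zn; rewrite leq_eqVlt => /predU1P[rz|]; last first.
  by rewrite ltnS => zn; rewrite weight_le // mulr1 IH.
have [b bb b0] := graded_bot gT.
have bz : (b < z)%O.
  by rewrite lt_neqAle (forallP bb) andbT; apply/eqP => e; move: rz; rewrite -e b0.
rewrite weight_eq // mulrN1; apply/eqP; rewrite eqr_oppLR; apply/eqP.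
rewrite -(sum_sgn_below bz); last by apply: semi_balanced => //; rewrite zt orbT.
apply: eq_big => u; first by rewrite inE (forallP bb).
rewrite inE => uz; apply: IH; last by rewrite -ltnS -rz lt_rank.
by rewrite -rank_lt_rk // (leq_trans (lt_rank uz)) // rank_le_rk.
Qed.

Lemma sgn_bot (b : T) : is_bot b -> sgn b = 1.
Proof. by move=> bb; rewrite /sgn bot_rank0. Qed.

Lemma sgn_top (t : T) : is_top t -> sgn t = - (-1) ^+ d.
Proof. by move=> tt; rewrite /sgn top_rank // -{1}(prednK rT) exprS mulN1r. Qed.

Lemma sum_sgn_above u : ~~ is_bot u -> ~~ is_top u ->
  \sum_(z | (u <= z)%O && ~~ is_top z) sgn z = (-1) ^+ d.
Proof.
move=> ub ut; case: (gT) => _ [t tt] _.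
have ut' : (u < t)%O.
  by rewrite lt_neqAle (forallP tt) andbT; apply: contraNneq ut => ->.
rewrite -[RHS]opprK -(sgn_top tt) -(sum_sgn_below ut'); last first.
  by apply: semi_balanced => //; rewrite ub.
apply: eq_bigl => z; congr andb; rewrite lt_neqAle (forallP tt) andbT; congr negb.
by apply/idP/eqP => [zt|->//]; apply: top_unique zt tt.
Qed.

Lemma euler_char_sgn : euler_char T = 1 - sgn_sum (T := T).
Proof.
rewrite euler_char_weight //; congr (_ - _); apply: eq_bigr => z zt.
by rewrite weight_sgn // rank_le_pred.
Qed.

(** Sum the products [sgn u * sgn z] over the pairs [u <= z] of elements that are
neither minimal nor maximal.  Summing over [z] first involves the intervals from
[u] to the maximum, summing over [u] first those from the minimum to [z]; all of
them are Eulerian. *)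
Lemma sgn_sum_even : (sgn_sum (T := T) - 1) * (1 + (-1) ^+ d) = 0.
Proof.
pose proper z := ~~ is_bot z && ~~ is_top z.
have [b bb b0] := graded_bot gT.
have bt : ~~ is_top b by rewrite -rank_lt_rk // b0.
have -> : sgn_sum (T := T) - 1 = \sum_(z : T | proper z) sgn z.
  rewrite /sgn_sum (bigD1 b) //= sgn_bot // addrAC subrr add0r.
  apply: eq_bigl => z; rewrite /proper andbC; congr (~~ _ && _).
  by apply/eqP/idP => [->//|zb]; apply: bot_unique zb bb.
rewrite mulrDr mulr1.
have E1 : \sum_(u : T | proper u) \sum_(z : T | proper z && (u <= z)%O) sgn u * sgn z
    = (\sum_(u : T | proper u) sgn u) * (-1) ^+ d.
  rewrite mulr_suml; apply: eq_bigr => u /andP[ub ut]; rewrite -mulr_sumr.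
  congr (_ * _); rewrite -(sum_sgn_above ub ut); apply: eq_bigl => z.
  rewrite /proper andbC; case uz: (u <= z)%O => //=; apply: andb_idl => _.
  apply: contraNN ub => zb; apply/forallP => v; apply: le_trans uz _.
  by have /forallP := zb; apply.
have E2 : \sum_(u : T | proper u) \sum_(z : T | proper z && (u <= z)%O) sgn u * sgn z
    = - \sum_(z : T | proper z) sgn z.
  rewrite (exchange_big_dep proper) /=; last by move=> u z _ /andP[].
  rewrite -sumrN; apply: eq_bigr => z /andP[zb zt]; rewrite -mulr_suml -mulN1r.
  congr (_ * _).
  have bz : (b < z)%O.
    by rewrite lt_neqAle (forallP bb) andbT; apply: contraNneq zb => <-.
  have := balanced_sum (semi_balanced bz _); rewrite zt orbT => /(_ isT).
  rewrite (bigD1 b) /= ?lexx ?(ltW bz) // sgn_bot // => /eqP.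
  rewrite addrC addr_eq0 => /eqP <-; apply: eq_bigl => u.
  rewrite /proper zb zt /= (forallP bb) /=; case uz: (u <= z)%O; rewrite ?andbF ?andbT //=.
  have -> : ~~ is_top u.
    apply: contraNN zt => ut; apply/forallP => v; apply: le_trans uz.
    by have /forallP := ut; apply.
  rewrite andbT; congr negb; apply/idP/eqP => [ub|->//]; exact: bot_unique ub bb.
by rewrite -E1 E2 subrr.
Qed.

(** The correction is put into the form in which the count of the coatoms above
the minimum produces it; the two agree by [sgn_sum_even]. *)
Lemma flag_poly_semi (R : nzRingType) (x y : R) :
  flag_poly T x y = \sum_(z : T | ~~ is_top z) weight x y d z
    + (if (0 < d)%N then x ^+ d.-1 * y else 0)
      *~ (1 - (-1) ^+ d * sgn_sum (T := T)).
Proof.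
rewrite flag_poly_weight // euler_char_sgn; congr (_ + _ *~ _).
apply/eqP; rewrite -subr_eq0 -sgn_sum_even; apply/eqP.
by rewrite /sphere_euler_char; move: (sgn_sum (T := T)) (_ ^+ d) => e s; ring.
Qed.

End SemiEulerian.

Lemma eulerian_semi disp (T : finPOrderType disp) : eulerian T -> semi_eulerian T.
Proof. by case=> gT eT; split=> // u z uz _; apply: eT. Qed.

Lemma flag_poly_eulerian disp (T : finPOrderType disp) (R : nzRingType) (x y : R) :
  eulerian T -> (0 < rk T)%N ->
  flag_poly T x y = \sum_(z : T | ~~ is_top z) weight x y (rk T).-1 z.
Proof.
move=> eT rT; have [gT _] := eT; have sT := eulerian_semi eT.
rewrite flag_poly_semi //; suff -> : sgn_sum (T := T) = (-1) ^+ (rk T).-1.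
  by rewrite -expr2 sqrr_sign subrr mulr0z addr0.
have [b bb b0] := graded_bot gT; case: (gT) => _ [t tt] _.
have bt : (b < t)%O.
  rewrite lt_neqAle (forallP bb) andbT; apply/eqP => e.
  by move: rT; rewrite -(top_rank tt) -e b0.
rewrite -[RHS]opprK -(sgn_top rT tt) -(sum_sgn_below bt (eT.2 _ _ bt)).
apply: eq_bigl => z; rewrite (forallP bb) /= lt_neqAle (forallP tt) andbT; congr negb.
by apply/idP/eqP => [zt|->//]; apply: top_unique zt tt.
Qed.

(** * Near-Eulerian lower sets *)

Lemma S_partitionable_rk disp (T : finPOrderType disp) :
   S_partitionable T -> (0 < rk T)%N.
Proof.
by case/S_partitionableP=> [[_ ->]|[s1 /S_partitionable_fromP[P [st [[_ /ltnW]]]]]].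
Qed.

Section LowerSets.
Context {disp : Order.disp_t} {T : finPOrderType disp}.
Implicit Types (A : {set T}) (x z : T).
Local Open Scope order_scope.

Lemma ideal_below x : ideal x :\ x = below x.
Proof. by apply/setP => z; rewrite !inE lt_neqAle. Qed.

Lemma lower_Ntop A :
  [set u : lower A | ~~ is_top u] = (fun x => insub x : lower A) @: A.
Proof.
apply/setP => u; rewrite inE lower_is_top; apply/idP/imsetP => [|[x xA ->]].
  by case: u => // u _; exists (val u); [exact: valP|rewrite insub_lower].
by rewrite (insubT (mem A) xA).
Qed.

Lemma insub_inj A : {in A &, injective (fun x => insub x : lower A)}.
Proof.
by move=> u v uA vA; rewrite (insubT (mem A) uA) (insubT (mem A) vA) => -[].
Qed.

Lemma sum_lower (R : nmodType) A (F : lower A -> R) :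
  (\sum_(u | ~~ is_top u) F u = \sum_(x in A) F (insub x))%R.
Proof.
rewrite -(big_imset _ (@insub_inj A)) /= -lower_Ntop.
by apply: eq_bigl => u; rewrite inE.
Qed.

Lemma flag_poly_lower (R : nzRingType) (x y : R) A : down_closed A ->
  S_partitionable (lower A) ->
  flag_poly (lower A) x y = (\sum_(z in A) weight x y (rk (lower A)).-1 z)%R.
Proof.
move=> dA SA; have eA := S_partitionable_eulerian SA.
rewrite (flag_poly_eulerian x y eA (S_partitionable_rk SA)).
rewrite sum_lower; apply: eq_bigr => z zA.
by apply: emb_weight (lower_embedding dA) _.
Qed.

End LowerSets.

Section NearEulerianPart.
Context {disp : Order.disp_t} {T : finPOrderType disp} (G : {set T}).
Local Notation L := (lower G).
Local Notation Sg := (semisuspension L).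
Hypotheses (dG : down_closed G) (gL : graded L).
Hypothesis SSg : S_partitionable_from (None : Sg).
Local Open Scope order_scope.

Let eS : eulerian Sg.
Proof. by have [P [st [[]]]] := S_partitionable_fromP SSg. Qed.

Let gS : graded Sg := eS.1.

Let r2 : (2 <= rk Sg)%N.
Proof. by have [P [st [[]]]] := S_partitionable_fromP SSg. Qed.

Let Nc : (None : Sg) \in coatoms Sg.
Proof. by have [P [st [_ []]]] := S_partitionable_fromP SSg. Qed.

Let rS : rk Sg = rk L := rk_semisuspension_from gL SSg.

Definition into_semisuspension (x : T) : Sg := Some (insub x : L).
Local Notation emb := into_semisuspension.

Lemma into_semisuspension_embedding : ideal_embedding G emb.
Proof.
have [_ fm fs] := lower_embedding dG; split=> // x [u|] xG.
  by move/(fs x u xG) => [y yG yu]; exists y; rewrite // /emb yu.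
by rewrite /emb (insubT (mem G) xG) /Order.le /= lower_is_top.
Qed.

Lemma boundary_sub : lower_boundary G \subset G.
Proof. by apply/subsetP => x; rewrite in_lower_boundary => /andP[]. Qed.

Lemma below_tau : below (None : Sg) = emb @: lower_boundary G.
Proof.
rewrite semisuspension_below; apply/setP => u; apply/imsetP/imsetP => -[x].
  case: x => [x|] xb ->; last by case: (is_top_boundaryF (lower_top G) xb).
  by exists (val x); rewrite ?in_lower_boundary /emb ?insub_lower ?(valP x).
by rewrite in_lower_boundary => /andP[xG xb] ->; exists (insub x).
Qed.

Lemma semisuspension_Ntop : [set u : Sg | ~~ is_top u] = None |: emb @: G.
Proof.
apply/setP => -[u|]; rewrite !inE /=.
  rewrite semisuspension_is_top -[LHS](in_set (fun u : L => ~~ is_top u)) lower_Ntop.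
  by apply/imsetP/imsetP => -[x xG]; [move=> ->; exists x|case=> ->; exists x].
by rewrite (ideal_coatom_Ntop Nc).
Qed.

Lemma tau_notin_emb (A : {set T}) : (None : Sg) \notin emb @: A.
Proof. by apply/negP => /imsetP[]. Qed.

Lemma emb_injG : {in G &, injective emb}.
Proof. exact: emb_inj into_semisuspension_embedding. Qed.

Lemma emb_inj_boundary : {in lower_boundary G &, injective emb}.
Proof. by apply: sub_in2 emb_injG; apply/subsetP/boundary_sub. Qed.

Lemma sum_semisuspension (R : nmodType) (F : Sg -> R) :
  (\sum_(u : Sg | ~~ is_top u) F u = F None + \sum_(x in G) F (emb x))%R.
Proof.
rewrite -(big_imset _ emb_injG) /= -(big_setU1 _ (tau_notin_emb G)) -semisuspension_Ntop.
by apply: eq_bigl => u; rewrite inE.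
Qed.

Let rN : rank (None : Sg) = (rk L).-1.
Proof. by rewrite -rS -(coatom_rank Nc). Qed.

Lemma boundary_iso :
  poset_iso (@lower_map _ _ _ emb (lower_boundary G) (below (None : Sg))).
Proof.
apply: lower_map_iso below_tau => x y /(subsetP boundary_sub) xG /(subsetP boundary_sub) yG.
by have [_ fm _] := into_semisuspension_embedding; apply: fm.
Qed.

Lemma S_partitionable_boundary :
  S_partitionable (lower (lower_boundary G)) /\
  (rk (lower (lower_boundary G))).+1 = rk L.
Proof.
have [P [st [_ [_ PN _ SN rN'] _ _ _]]] := S_partitionable_fromP SSg.
rewrite PN ideal_below in SN rN'.
split; first exact: (S_partitionable_iso boundary_iso).1.
by rewrite -(iso_rk boundary_iso) rN'.
Qed.

Lemma flag_poly_boundary (R : nzRingType) (x y : R) :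
  flag_poly (lower (lower_boundary G)) x y
  = (\sum_(z in lower_boundary G) weight x y (rk L).-2 z)%R.
Proof.
have [SB <-] := S_partitionable_boundary.
by apply: flag_poly_lower => //; apply: lower_boundary_closed.
Qed.

Lemma flag_poly_semisuspension (R : nzRingType) (x y : R) :
  flag_poly Sg x y = (\sum_(z in G) weight x y (rk L).-1 z
    + (\sum_(z in lower_boundary G) weight x y (rk L).-2 z) * y)%R.
Proof.
rewrite flag_poly_eulerian //; last exact: ltnW.
rewrite sum_semisuspension rS addrC; congr (_ + _)%R.
  by apply: eq_bigr => z zG; apply: emb_weight into_semisuspension_embedding _.
have d2 : (rk L).-1 = (rk L).-2.+1 by rewrite -rS; case: (rk Sg) r2 => [|[]].
rewrite d2 weight_eq ?rN //; congr (_ * _)%R; rewrite below_tau big_imset /=; last exact: emb_inj_boundary.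
apply: eq_bigr => z /(subsetP boundary_sub) zG.
exact: emb_weight into_semisuspension_embedding _.
Qed.

Lemma weight_boundary (R : nzRingType) (x y : R) z : z \in lower_boundary G ->
  (weight x y (rk L).-1 z = weight x y (rk L).-2 z * x)%R.
Proof.
move=> zb; have : emb z < None.
  by rewrite -[_ < _](in_set (fun u : Sg => u < None)) -/(below (None : Sg)) below_tau imset_f.
move/lt_rank; rewrite rN (emb_rank into_semisuspension_embedding) ?(subsetP boundary_sub) //.
by case: (rk L).-1 => // n; rewrite ltnS => zn; rewrite weight_le.
Qed.

(** Euler's relation for the interval from [z0] to the maximum of the
semisuspension; if [z0] is on the boundary, the relation for the interval from
[z0] to the added coatom shows that the boundary and that coatom cancel. *)
Lemma sum_sgn_interior z0 : z0 \in G ->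
  (\sum_(z in G :\: lower_boundary G | (z0 <= z)%O) sgn z = - (-1) ^+ rk L)%R.
Proof.
move=> z0G; have emb_sgn z : z \in G -> sgn (emb z) = sgn z.
  by move=> zG; rewrite /sgn (emb_rank into_semisuspension_embedding).
have [_ fm _] := into_semisuspension_embedding.
have tS : is_top (Some None : Sg) by rewrite semisuspension_is_top lower_top.
have lt_top (u : Sg) : (u < Some None)%O = ~~ is_top u.
  rewrite lt_neqAle (forallP tS) andbT; congr negb.
  by apply/eqP/idP => [->//|ut]; apply: top_unique ut tS.
have z0t : (emb z0 < Some None)%O.
  by rewrite /emb (insubT (mem G) z0G) lt_top semisuspension_is_top lower_is_top.
have := sum_sgn_below z0t (eS.2 _ _ z0t).
have -> : sgn (Some None : Sg) = ((-1) ^+ rk L)%R by rewrite /sgn top_rank ?rS.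
move=> <-; rewrite [RHS](eq_bigl (fun v => ~~ is_top v && (emb z0 <= v))); last first.
  by move=> v; rewrite lt_top andbC.
rewrite [RHS]big_mkcondr sum_semisuspension [LHS]big_mkcondr /=.
rewrite [X in (_ = _ + X)%R](big_setID (lower_boundary G)) /= (setIidPr boundary_sub).
have sgnG z : z \in G -> (if emb z0 <= emb z then sgn (emb z) else 0%R)
    = (if z0 <= z then sgn z else 0%R).
  by move=> zG; rewrite fm // emb_sgn.
rewrite [X in (_ = _ + (_ + X))%R](eq_bigr (fun z => if z0 <= z then sgn z else 0%R));
  last by move=> z; rewrite inE => /andP[_ /sgnG].
rewrite addrA -[LHS]add0r; congr (_ + _)%R.
have lb z : z \in G -> (emb z < None) = (z \in lower_boundary G).
  move=> zG; rewrite -[LHS](in_set (fun u : Sg => u < None)) -/(below (None : Sg)) below_tau.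
  apply/imsetP/idP => [[v vb]|zb]; last by exists z.
  by move/(emb_injG zG ((subsetP boundary_sub) _ vb)) => ->.
have leN (u : T) : (emb u <= None) = (emb u < None) by rewrite lt_neqAle.
rewrite leN lb //; case: ifP => z0b.
  have z0N : emb z0 < None by rewrite lb.
  have E := sum_sgn_below z0N (eS.2 _ _ z0N).
  apply/esym/eqP; rewrite addrC addr_eq0 -E; apply/eqP.
  rewrite [RHS](eq_bigl (fun v => (v \in below (None : Sg)) && (emb z0 <= v))); last first.
    by move=> v; rewrite inE andbC.
  rewrite big_mkcondr below_tau [RHS]big_imset /=; last exact: emb_inj_boundary.
  by apply: eq_bigr => z zb; rewrite sgnG // (subsetP boundary_sub).
rewrite add0r big1 // => z zb; rewrite sgnG ?(subsetP boundary_sub) //.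
case: ifP => // z0z; case/negP: z0b; exact: (lower_boundary_closed dG) zb z0z.
Qed.

End NearEulerianPart.

(** * The recursion for flag polynomials *)

Section Recursion.
Context {disp : Order.disp_t} {T : finPOrderType disp}.
Variables (s1 : T) (P : T -> {set T}) (Q : T -> {set {set T}}).
Hypotheses (sT : semi_eulerian T) (hP : SE_partition s1 P Q).
Local Notation d := (rk T).-1.
Local Notation nontrivial s := ((s != s1) && (P s != [set s])).
Local Notation bd B := (lower_boundary (down_closure B)).

Let gT : graded T := sT.1.

Let rT : (2 <= rk T)%N.
Proof. by case: hP. Qed.

Let rd : rk T = d.+1.
Proof. by rewrite prednK // ltnW. Qed.

Let d0 : (0 < d)%N.
Proof. by rewrite -ltnS -rd. Qed.

Let cP : coatom_partition P.
Proof. by case: hP. Qed.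

Let s1c : s1 \in coatoms T.
Proof. by case: hP => _ _ []. Qed.

Let Ps1 : P s1 = ideal s1.
Proof. by case: hP => _ _ []. Qed.

Let Ss1 : S_partitionable (lower (below s1)).
Proof. by rewrite -ideal_below -Ps1; case: hP => _ _ []. Qed.

Let rs1 : rk (lower (below s1)) = d.
Proof.
by rewrite -ideal_below -Ps1; case: hP => _ _ [_ _ _ _ e] _; rewrite -e.
Qed.

Let partQ s : s \in coatoms T -> nontrivial s -> partition (Q s) (P s :\ s).
Proof.
move=> sc /andP[ss1 Pss]; case: hP => _ _ _ /(_ s sc ss1) [e|[]//].
by rewrite e eqxx in Pss.
Qed.

Lemma SE_subclass s B : s \in coatoms T -> nontrivial s -> B \in Q s ->
  [/\ down_closure B :\: bd B = B, graded (lower (down_closure B)),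
      rk (lower (down_closure B)) = d
    & S_partitionable_from (None : semisuspension (lower (down_closure B)))].
Proof.
move=> sc /andP[ss1 Pss] BQ; case: hP => _ _ _ /(_ s sc ss1) [e|[_]].
  by rewrite e eqxx in Pss.
move/(_ B BQ) => [GE dis [gL _] e SB]; split=> //; last by rewrite -e.
by rewrite {1}GE setDUl setDv setU0; apply/setDidPl.
Qed.

Let coatom_rk s : s \in coatoms T -> rank s = d.
Proof. by move/coatom_rank => <-. Qed.

Lemma sum_by_class (V : nmodType) (F : T -> V) :
  \sum_(z : T | ~~ is_top z) F z
  = \sum_(s in coatoms T) F s + (\sum_(z in below s1) F z
    + \sum_(s in coatoms T | nontrivial s) \sum_(B in Q s) \sum_(z in B) F z).
Proof.
have [Pinj PT _] := cP.
have -> : \sum_(z : T | ~~ is_top z) F z = \sum_(z in [set x : T | ~~ is_top x]) F z.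
  by apply: eq_bigl => z; rewrite inE.
rewrite (set_partition_big _ PT) /= big_imset //=.
rewrite (eq_bigr (fun s => F s + \sum_(z in P s :\ s) F z)); last first.
  by move=> s sc; rewrite (big_setD1 s) //; apply: coatom_in_class.
rewrite big_split /=; congr (_ + _).
rewrite (bigD1 s1) //= Ps1 ideal_below; congr (_ + _).
rewrite (bigID (fun s => P s == [set s])) /= big1 ?add0r; last first.
  by move=> s /andP[_ /eqP ->]; rewrite setDv big_set0.
apply: eq_big => [s|s /andP[/andP[sc ss1] Pss]]; first by rewrite -andbA.
by rewrite (set_partition_big _ (partQ sc _)) // ss1.
Qed.

Let part_lt s B z : s \in coatoms T -> nontrivial s -> B \in Q s -> z \in B ->
  (z < s)%O.
Proof.
move=> sc cs BQ zB; have : z \in P s :\ s.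
  by have /and3P[/eqP <- _ _] := partQ sc cs; apply/bigcupP; exists B.
rewrite !inE lt_neqAle => /andP[-> zP].
by have [_ _ /(_ s sc)/subsetP/(_ z zP)] := cP; rewrite inE.
Qed.

Let bd_rank s B z : s \in coatoms T -> nontrivial s -> B \in Q s -> z \in bd B ->
  (rank z < d)%N.
Proof.
move=> sc cs BQ /(subsetP (boundary_sub _)); rewrite inE => /exists_inP[u uB zu].
by rewrite -(coatom_rk sc) lt_rank // (le_lt_trans zu) // (part_lt sc cs BQ).
Qed.

Lemma sum_by_part (V : nmodType) (F : T -> V) :
  \sum_(z : T | (rank z < d)%N) F z
  = \sum_(z in below s1) F z
    + \sum_(s in coatoms T | nontrivial s) \sum_(B in Q s) \sum_(z in B) F z.
Proof.
pose F' z := if (rank z < d)%N then F z else 0.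
transitivity (\sum_(z : T | ~~ is_top z) F' z).
  rewrite -big_mkcondr; apply: eq_bigl => z; apply/idP/andP => [zd|[]//].
  by split=> //; rewrite -rank_lt_rk // rd ltnW.
rewrite sum_by_class big1 ?add0r; last first.
  by move=> s sc; rewrite /F' coatom_rk // ltnn.
congr (_ + _).
  by apply: eq_bigr => z; rewrite inE /F' => /lt_rank; rewrite (coatom_rk s1c) => ->.
apply: eq_bigr => s /andP[sc cs]; apply: eq_bigr => B BQ; apply: eq_bigr => z zB.
by rewrite /F' -(coatom_rk sc) lt_rank // (part_lt sc cs BQ).
Qed.

(** Add up the signs of all elements above [z0] class by class.  A coatom above
[z0] contributes [(-1) ^+ d], the class of [s1] without [s1] contributes the
opposite if [z0 < s1], and each sub-class the opposite if its closure contains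
[z0] ([sum_sgn_interior]).  The total is known from Euler's relation above [z0],
unless [z0] is the minimum.  Since [z0] lies either below [s1] or in exactly one
sub-class, the number of these opposite contributions is 1 plus the number of
boundaries that contain [z0]. *)
Lemma coatoms_above z0 : (rank z0 < d)%N ->
  (\sum_(s in coatoms T) ((z0 < s)%O)%:R : int)
  = 2%:R - (if is_bot z0 then 1 - (-1) ^+ d * sgn_sum (T := T) else 0)
    + \sum_(s in coatoms T | nontrivial s) \sum_(B in Q s) (z0 \in bd B)%:R.
Proof.
move=> z0d; set N := \sum_(s in coatoms T) _; set D := \sum_(s in _ | _) _.
pose inG : int := \sum_(s in coatoms T | nontrivial s) \sum_(B in Q s) (z0 \in down_closure B)%:R.
have z0c s : s \in coatoms T -> (z0 <= s)%O = (z0 < s)%O.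
  move=> sc; rewrite le_eqVlt; case: eqP => // e.
  by move: z0d; rewrite e coatom_rk // ltnn.
have z0t : ~~ is_top z0 by rewrite -rank_lt_rk // rd ltnW.
(* z0 lies in exactly one part; inG - D counts the sub-classes that contain z0 *)
pose in1 : int := (z0 < s1)%O%:R.
have one : in1 + (inG - D) = 1.
  symmetry.
  transitivity (\sum_(z : T | (rank z < d)%N) (z0 == z)%:R : int).
    rewrite (bigD1 z0) //= eqxx big1 ?addr0 // => z /andP[_ /negbTE].
    by rewrite eq_sym => ->.
  rewrite sum_by_part /in1; congr (_ + _).
    have [lt|nlt] := boolP (z0 < s1)%O.
      rewrite (bigD1 z0) ?inE //= eqxx big1 ?addr0 // => z /andP[_ /negbTE].
      by rewrite eq_sym => ->.
    rewrite big1 // => z; rewrite inE => zs1; case: eqP => // e.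
    by rewrite e zs1 in nlt.
  rewrite -sumrB; apply: eq_bigr => s /andP[sc cs].
  rewrite -sumrB; apply: eq_bigr => B BQ; have [GB _ _ _] := SE_subclass sc cs BQ.
  transitivity ((z0 \in B)%:R : int).
    have [zB|zB] := boolP (z0 \in B).
      rewrite (bigD1 z0) //= eqxx big1 ?addr0 // => z /andP[_ /negbTE].
      by rewrite eq_sym => ->.
    by rewrite big1 // => z zB'; case: eqP => // e; rewrite e zB' in zB.
  rewrite -{1}GB inE; have /subsetP/(_ z0) := boundary_sub (down_closure B).
  by case: (z0 \in bd B) => [->|_] //; rewrite subr0.
pose W : int := \sum_(z : T | ~~ is_top z) (if (z0 <= z)%O then sgn z else 0).
have EW : W = (-1) ^+ d * (N - in1 - inG).
  rewrite /W sum_by_class mulrBr mulrBr -addrA; congr (_ + (_ + _)).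
  - rewrite mulr_sumr; apply: eq_bigr => s sc; rewrite z0c //.
    by rewrite /sgn coatom_rk //; case: ifP => _; rewrite ?mulr1 ?mulr0.
  - rewrite -big_mkcondr /in1; have [lt|nlt] := boolP (z0 < s1)%O.
      rewrite mulr1 -(coatom_rk s1c) -/(sgn s1) -(sum_sgn_below lt).
        by apply: eq_bigl => z; rewrite inE andbC.
      apply: semi_balanced => //; apply/orP; right.
      exact: ideal_coatom_Ntop s1c (lexx _).
    rewrite mulr0 oppr0 big1 // => z /andP[]; rewrite inE => zs z0z.
    by rewrite (le_lt_trans z0z zs) in nlt.
  - rewrite -mulrN /inG -sumrN mulr_sumr; apply: eq_bigr => s /andP[sc cs].
    rewrite -sumrN mulr_sumr; apply: eq_bigr => B BQ; rewrite -big_mkcondr.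
    have [GB gL rL SL] := SE_subclass sc cs BQ.
    have [zG|zG] := boolP (z0 \in down_closure B).
      by rewrite -{1}GB sum_sgn_interior // ?rL ?mulrN1 //; apply: down_closure_closed.
    rewrite oppr0 mulr0 big1 // => z /andP[zB z0z]; case/negP: zG.
    by apply: down_closure_closed z0z; rewrite -GB inE in zB; case/andP: zB.
have {EW} EN : N = (-1) ^+ d * W + 1 + D.
  clearbody in1; rewrite EW mulrA -expr2 sqrr_sign mul1r.
  by rewrite -one; ring.
rewrite EN; congr (_ + _).
have [zb|zb] := boolP (is_bot z0).
  have -> : W = sgn_sum (T := T).
    by apply: eq_bigr => z _; rewrite (forallP zb).
  by move: (_ ^+ d) (sgn_sum (T := T)) => a e; ring.
have -> : W = (-1) ^+ d.
  rewrite -(sum_sgn_above sT (ltnW rT) zb z0t) /W -big_mkcondr.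
  by apply: eq_bigl => z; apply: andbC.
by rewrite -expr2 sqrr_sign subr0.
Qed.


Section FlagRecursion.
Variables (R : nzRingType) (x y : R).

Lemma sum_coatoms_weight :
  \sum_(s in coatoms T) \sum_(z in below s) weight x y d.-1 z
  = (\sum_(z : T | (rank z < d)%N) weight x y d.-1 z) *+ 2
    - x ^+ d.-1 *~ (1 - (-1) ^+ d * sgn_sum (T := T))
    + \sum_(s in coatoms T | nontrivial s) \sum_(B in Q s)
        \sum_(z in bd B) weight x y d.-1 z.
Proof.
pose F (z : T) : R := weight x y d.-1 z.
transitivity (\sum_(z : T | (rank z < d)%N)
    F z *~ \sum_(s in coatoms T) ((z < s)%O)%:R).
  transitivity (\sum_(s in coatoms T) \sum_(z : T | (rank z < d)%N)
      F z *~ ((z < s)%O)%:R).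
    apply: eq_bigr => s sc; rewrite big_mkcond [RHS]big_mkcond /=.
    apply: eq_bigr => z _; rewrite inE; case zs: (z < s)%O.
      by have := lt_rank zs; rewrite (coatom_rk sc) mulr1z => ->.
    by rewrite mulr0z if_same.
  by rewrite exchange_big; apply: eq_bigr => z _; rewrite mulrz_sumr.
transitivity (\sum_(z : T | (rank z < d)%N) (F z *+ 2
   - (if is_bot z then F z *~ (1 - (-1) ^+ d * sgn_sum (T := T)) else 0)
   + \sum_(s in coatoms T | nontrivial s) \sum_(B in Q s)
        (if z \in bd B then F z else 0))).
  apply: eq_bigr => z zd; rewrite coatoms_above // mulrzDr mulrzBr; congr (_ - _ + _).
    by case: ifP => _; rewrite ?mulr0z.
  rewrite mulrz_sumr; apply: eq_bigr => s _; rewrite mulrz_sumr; apply: eq_bigr => B _.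
  by case: (z \in bd B).
rewrite big_split sumrB /= sumrMnl; congr (_ - _ + _).
  have [b bb b0] := graded_bot gT.
  rewrite -big_mkcondr (big_pred1 b) /F ?weight_bot // => z.
  apply/andP/eqP => [[_ zb]|->]; first exact: bot_unique zb bb.
  by rewrite b0.
rewrite exchange_big; apply: eq_bigr => s /andP[sc cs].
rewrite exchange_big; apply: eq_bigr => B BQ; rewrite -big_mkcondr.
apply: eq_bigl => z; apply: andb_idl; exact: bd_rank sc cs BQ.
Qed.

(** Here [p] is the sum of the weights of a sub-class and [q] the flag polynomial
of the boundary of its closure, so that [p + q * x + q * y] is the flag
polynomial of the semisuspension. *)
Lemma recursion_term (p q : R) :
  (p + q * x + q * y - q * (x + y + y)) * (x + y + y)
    + q * ((x + y) * y + y * (x + y))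
  = p * (x + y + y) + q * x * y.
Proof.
have -> : p + q * x + q * y - q * (x + y + y) = p - q * y.
  have E (u v : R) : p + u - (u + v) = p - v by rewrite opprD addrA addrK.
  by rewrite !mulrDr -(addrA p) E.
have -> : (x + y) * y + y * (x + y) = x * y + y * (x + y + y).
  by rewrite mulrDl -addrA -mulrDr (addrC y (x + y)).
move: (x + y + y) => c.
by rewrite mulrBl mulrDr !mulrA -addrA (addrC (- _)) addrK.
Qed.

(** For [x = a - b] and [y = b], the factor [x + y + y] is the value [a + b] of c
and the last factor is the value [ab + ba] of d. *)
Theorem flag_poly_recursion :
  flag_poly T x y = flag_poly (lower (P s1 :\ s1)) x y * (x + y + y)
  + \sum_(s in coatoms T | nontrivial s) \sum_(B in Q s)
      ((flag_poly (semisuspension (lower (down_closure B))) x y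
        - flag_poly (lower (bd B)) x y * (x + y + y)) * (x + y + y)
       + flag_poly (lower (bd B)) x y * ((x + y) * y + y * (x + y))).
Proof.
pose p (B : {set T}) := \sum_(z in B) weight x y d.-1 z.
pose q (B : {set T}) := \sum_(z in bd B) weight x y d.-2 z.
have qx s B : s \in coatoms T -> nontrivial s -> B \in Q s ->
    \sum_(z in bd B) weight x y d.-1 z = q B * x.
  move=> sc cs BQ; have [_ gL rL SL] := SE_subclass sc cs BQ.
  rewrite mulr_suml; apply: eq_bigr => z zb; rewrite -rL.
  by apply: weight_boundary zb => //; apply: down_closure_closed.
rewrite [X in _ = _ + X](eq_bigr (fun s => \sum_(B in Q s)
    (p B * (x + y + y) + q B * x * y))); last first.
  move=> s /andP[sc cs]; apply: eq_bigr => B BQ.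
  have [GB gL rL SL] := SE_subclass sc cs BQ.
  have dG := @down_closure_closed _ _ B.
  rewrite flag_poly_semisuspension // flag_poly_boundary // rL -/(q B).
  rewrite -recursion_term; congr ((_ + _ - _) * _ + _).
  rewrite (big_setID (bd B)) (setIidPr (boundary_sub _)) GB addrC.
  by rewrite -/(p B) (qx s).
have Ep : \sum_(z : T | (rank z < d)%N) weight x y d.-1 z = p (below s1)
    + \sum_(s in coatoms T | nontrivial s) \sum_(B in Q s) p B.
  exact: sum_by_part.
rewrite Ps1 ideal_below flag_poly_lower //; last exact: below_closed.
rewrite rs1 -/(p _) flag_poly_semi // ?(ltnW rT) // d0.
rewrite (bigID (fun z => (rank z < d)%N)) /=.
have -> : \sum_(z : T | ~~ is_top z && (rank z < d)%N) weight x y d z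
    = (\sum_(z : T | (rank z < d)%N) weight x y d.-1 z) * x.
  have d1 : d = d.-1.+1 by rewrite prednK.
  rewrite mulr_suml; apply: eq_big => z.
    by apply: andb_idl => zd; rewrite -rank_lt_rk // rd ltnW.
  by case/andP=> _ zd; rewrite {1}d1 weight_le // -ltnS -d1.
have -> : \sum_(z : T | ~~ is_top z && ~~ (rank z < d)%N) weight x y d z
    = (\sum_(s in coatoms T) \sum_(z in below s) weight x y d.-1 z) * y.
  have d1 : d = d.-1.+1 by rewrite prednK.
  rewrite mulr_suml; apply: eq_big => z.
    rewrite -rank_lt_rk // inE rd eqSS -leqNgt ltnS; apply/andP/eqP => [[]|->//].
    by move=> zd dz; apply: anti_leq; rewrite zd.
  case/andP; rewrite -rank_lt_rk // rd ltnS -leqNgt => zd dz.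
  by rewrite {1}d1 weight_eq // -d1; apply: anti_leq; rewrite zd.
rewrite sum_coatoms_weight Ep.
rewrite [X in (_ - _ + X) * y](eq_bigr (fun s => \sum_(B in Q s) q B * x)); last first.
  by move=> s /andP[sc cs]; apply: eq_bigr => B BQ; apply: (qx s).
set A := \sum_(s in _ | _) \sum_(B in Q s) p B.
set A' := \sum_(s in _ | _) \sum_(B in Q s) q B * x.
have -> : \sum_(s in coatoms T | nontrivial s) \sum_(B in Q s)
    (p B * (x + y + y) + q B * x * y) = A * (x + y + y) + A' * y.
  rewrite !mulr_suml -big_split; apply: eq_bigr => s _.
  by rewrite !mulr_suml -big_split.
move: (p _) (x ^+ _) (1 - _) => S1 X c.
rewrite addrA -mulrDl; move: (S1 + A) => u.
rewrite mulr2n !mulrDl mulNr mulrzAl !mulrDr -!addrA.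
by congr (_ + (_ + (_ + _))); rewrite addrC addrK.
Qed.

End FlagRecursion.

End Recursion.

(** * The recursion for cd-indices *)

Lemma flag_poly_iso disp (T U : finPOrderType disp) (f : T -> U)
    (R : nzRingType) (x y : R) :
  poset_iso f -> eulerian U -> (0 < rk U)%N -> flag_poly T x y = flag_poly U x y.
Proof.
move=> isof eU rU.
have [eT rT] : eulerian T /\ (0 < rk T)%N.
  by split; [exact: iso_eulerian isof eU|rewrite -(iso_rk isof)].
rewrite !flag_poly_eulerian // (iso_rk isof) [RHS](reindex f) /=; last exact/onW_bij/iso_bij.
apply: eq_big => [z|z _]; first by rewrite (iso_top isof).
by rewrite (emb_weight _ _ _ (iso_embedding isof)) ?inE.
Qed.

Lemma flag_poly_rank1 disp (T : finPOrderType disp) (R : nzRingType) (x y : R) :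
  semi_eulerian T -> rk T = 1%N -> flag_poly T x y = 1.
Proof.
move=> sT r1; rewrite flag_poly_semi ?r1 // mul0rz addr0.
have [b bb b0] := graded_bot sT.1.
rewrite (big_pred1 b) ?weight_bot // => z.
rewrite -(rank_lt_rk sT.1) r1 ltnS leqn0 (rank_eq0 sT.1).
by apply/idP/eqP => [zb|->//]; apply: bot_unique zb bb.
Qed.

Section CdRecursion.
Context {disp : Order.disp_t} {T : finPOrderType disp}.
Variables (s1 : T) (P : T -> {set T}) (Q : T -> {set {set T}}).
Hypotheses (sT : semi_eulerian T) (hP : SE_partition s1 P Q).
Local Notation nontrivial s := ((s != s1) && (P s != [set s])).
Local Notation bd B := (lower_boundary (down_closure B)).
Local Notation sp B := (semisuspension (lower (down_closure B))).
Local Notation c := (ncvar false).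
Local Notation dd := (ncvar true).

Definition cd_recursion : ncpoly :=
  cd_index (lower (P s1 :\ s1)) * c
  + \sum_(s in coatoms T | nontrivial s) \sum_(B in Q s)
      ((cd_index (sp B) - cd_index (lower (bd B)) * c) * c
       + cd_index (lower (bd B)) * dd).

Lemma cd_recursion_value (R : nzRingType) (a b : R) :
  let E := nceval (a + b) (a * b + b * a) in
  E (cd_index (lower (P s1 :\ s1))) = flag_poly (lower (P s1 :\ s1)) (a - b) b ->
  (forall s B, s \in coatoms T -> nontrivial s -> B \in Q s ->
    E (cd_index (sp B)) = flag_poly (sp B) (a - b) b /\
    E (cd_index (lower (bd B))) = flag_poly (lower (bd B)) (a - b) b) ->
  E cd_recursion = flag_poly T (a - b) b.
Proof.
move=> /= E1 EB; rewrite (flag_poly_recursion sT hP) /cd_recursion.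
rewrite subrK rmorphD rmorphM /= E1 nceval_var; congr (_ + _).
rewrite rmorph_sum /=; apply: eq_bigr => s /andP[sc cs].
rewrite rmorph_sum /=; apply: eq_bigr => B BQ; have [Es Eb] := EB s B sc cs BQ.
by rewrite rmorphD !rmorphM rmorphB rmorphM /= Es Eb !nceval_var.
Qed.

End CdRecursion.

Lemma S_partitionable_from_SE disp (T : finPOrderType disp) (s1 : T) :
  S_partitionable_from s1 -> exists P Q, SE_partition s1 P Q.
Proof.
case/S_partitionable_fromP=> P [st [[eT r2 cP] h1 [stc Pst ut] hN hS]].
exists P, (fun s => [set P s :\ s]); split=> // s sc ss1.
have [-> | sst] := eqVneq s st; first by left.
right; have [nG rG eG dG] := hN s sc ss1 sst.
have nz : P s :\ s != set0.
  apply: contra_neq sst => Ps0; apply: ut => //.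
  by rewrite -(setD1K (coatom_in_class cP sc)) Ps0 setU0.
split; last by move=> B; rewrite inE => /eqP ->; split=> //; apply: hS.
apply/and3P; split; first by rewrite /cover big_set1.
  by apply/trivIsetP => A B; rewrite !inE => /eqP -> /eqP ->; rewrite eqxx.
by rewrite inE eq_sym.
Qed.

Definition nonneg (p : ncpoly) : Prop := forall m, 0 <= p@_m.

Lemma nonneg1 : nonneg 1.
Proof. by move=> m; rewrite mcoeff1 ler0n. Qed.

Lemma nonneg_var l : nonneg (ncvar l).
Proof. by move=> m; rewrite mcoeffU1 ler0n. Qed.

Lemma nonnegD p q : nonneg p -> nonneg q -> nonneg (p + q).
Proof. by move=> p0 q0 m; rewrite mcoeffD addr_ge0. Qed.

Lemma nonnegM p q : nonneg p -> nonneg q -> nonneg (p * q).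
Proof.
move=> p0 q0 m; rewrite mcoeffMl sumr_ge0 // => k1 _; apply: sumr_ge0 => k2 _.
by rewrite mulrn_wge0 // mulr_ge0.
Qed.

Lemma nonneg_sum (I : Type) (r : seq I) (A : pred I) (F : I -> ncpoly) :
  (forall i, A i -> nonneg (F i)) -> nonneg (\sum_(i <- r | A i) F i).
Proof.
move=> F0 m; rewrite raddf_sum; apply: sumr_ge0 => i Ai; exact: F0.
Qed.

Lemma cd_index_iso disp (T U : finPOrderType disp) (f : T -> U) :
  poset_iso f -> eulerian U -> (0 < rk U)%N ->
  (exists Phi, is_cd_index U Phi) -> cd_index T = cd_index U.
Proof.
move=> isof eU rU [Phi PhiU]; rewrite (cd_index_unique PhiU).2.
apply: (cd_index_unique _).2; rewrite /is_cd_index (flag_poly_iso _ _ isof eU rU).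
exact: PhiU.
Qed.

(** By induction on the rank.  The last claim, for a semisuspension and its added
coatom, gives the non-negative difference Phi(semisuspension) - Phi(boundary) c
in the terms of the recursion. *)
Lemma cd_index_SE disp (T : finPOrderType disp) : SE_partitionable T ->
  [/\ exists Phi, is_cd_index T Phi,
      nonneg (cd_index T)
    & forall (s1 : T) P Q, SE_partition s1 P Q ->
        cd_index T = cd_recursion s1 P Q /\
        nonneg (cd_index T - cd_index (lower (P s1 :\ s1)) * ncvar false)].
Proof.
have [n] := ubnP (rk T); elim: n T => // n IH T rT [sT hT].
case: hT => [r1|[s1' [P' [Q' hP']]]].
  have c1 : is_cd_index T 1 by rewrite /is_cd_index flag_poly_rank1 // rmorph1.
  have [_ ->] := cd_index_unique c1; split; first by exists 1.
    exact: nonneg1.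
  by move=> s1 P Q []; rewrite r1.
suff rec (s1 : T) P Q : SE_partition s1 P Q ->
  [/\ is_cd_index T (cd_recursion s1 P Q), nonneg (cd_index (lower (P s1 :\ s1)))
    & nonneg (cd_recursion s1 P Q - cd_index (lower (P s1 :\ s1)) * ncvar false)].
  have [c1 n1 d1] := rec _ _ _ hP'; split; first by exists (cd_recursion s1' P' Q').
    rewrite (cd_index_unique c1).2 -[cd_recursion _ _ _](subrK (cd_index (lower (P' s1' :\ s1')) * ncvar false)).
    by apply: nonnegD => //; apply: nonnegM => //; apply: nonneg_var.
  by move=> s1 P Q /rec[c2 n2 d2]; rewrite (cd_index_unique c2).2.
move=> hP; have [r2 _ [s1c _ _ S1 rk1] _] := hP.
have lt_n (U : finPOrderType disp) : (rk U < rk T)%N -> (rk U < n)%N.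
  by move=> UT; rewrite -ltnS (leq_trans _ rT).
have [[Phi1 PhiE1] n1 _] := IH _ (lt_n _ (eq_leq rk1)) (S_partitionable_SE S1).
have cd1 : is_cd_index _ _ := (cd_index_unique PhiE1).1.1.
have part (s : T) (B : {set T}) : s \in coatoms T -> (s != s1) && (P s != [set s]) -> B \in Q s ->
  let Sg := semisuspension (lower (down_closure B)) in
  let bd := lower (lower_boundary (down_closure B)) in
  [/\ is_cd_index Sg (cd_index Sg), is_cd_index bd (cd_index bd),
      nonneg (cd_index bd) & nonneg (cd_index Sg - cd_index bd * ncvar false)].
  move=> sc cs BQ; have [_ gL rL SL] := SE_subclass hP sc cs BQ.
  have dG := @down_closure_closed _ _ B.
  have [Sb rb] := S_partitionable_boundary dG gL SL.
  have rLT : (rk (lower (down_closure B)) < rk T)%N by rewrite rL prednK // ltnW.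
  have rbT : (rk (lower (lower_boundary (down_closure B))) < rk T)%N.
    by apply: leq_trans rLT; rewrite -rb.
  have rST : (rk (semisuspension (lower (down_closure B))) < rk T)%N.
    by rewrite rk_semisuspension_from.
  have [[Phi PhiE] nb _] := IH _ (lt_n _ rbT) (S_partitionable_SE Sb).
  have [[Psi PsiE] nS dS] := IH _ (lt_n _ rST) (S_partitionable_SE (S_partitionable_rank_ge2 SL)).
  split; [exact: (cd_index_unique PsiE).1.1|exact: (cd_index_unique PhiE).1.1|exact: nb|].
  have [PS [QS hS]] := S_partitionable_from_SE SL.
  have [_ _ [_ PN _ SN rkN] _] := hS.
  have := (dS _ _ _ hS).2; rewrite PN ideal_below.
  rewrite PN ideal_below in SN rkN.
  rewrite (cd_index_iso (boundary_iso dG)) //.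
  - exact: S_partitionable_eulerian.
  - exact: S_partitionable_rk.
  - have rNT : (rk (lower (below (None : semisuspension (lower (down_closure B))))) < rk T)%N.
      by apply: leq_trans rST; rewrite rkN.
    by have [] := IH _ (lt_n _ rNT) (S_partitionable_SE SN).
split=> //.
  apply: (cd_recursion_value sT hP) => [|s B sc cs BQ]; first exact: cd1.
  by have [cS cb _ _] := part s B sc cs BQ; split; [exact: cS|exact: cb].
rewrite /cd_recursion addrC addKr; apply: nonneg_sum => s /andP[sc cs].
apply: nonneg_sum => B BQ; have [_ _ nb nS] := part s B sc cs BQ.
by apply: nonnegD => //; apply: nonnegM => //; apply: nonneg_var.
Qed.

Theorem theoremB (disp : Order.disp_t) (T : finPOrderType disp)
    (hT : SE_partitionable T) :
  let c := ncvar false in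
  let d := ncvar true in
  [/\ unique (is_cd_index T) (cd_index T),
      rk T = 1%N -> cd_index T = 1,
      forall (s1 : T) (P : T -> {set T}) (Q : T -> {set {set T}}),
        SE_partition s1 P Q ->
        [/\ S_partitionable (lower (P s1 :\ s1)),
            forall (s : T) (B : {set T}),
              s \in coatoms T -> s != s1 -> P s != [set s] -> B \in Q s ->
              [/\ S_partitionable (semisuspension (lower (down_closure B))),
                  S_partitionable (lower (lower_boundary (down_closure B)))
                & (rk (lower (lower_boundary (down_closure B)))).+2 = rk T]
          & cd_index T =
              cd_index (lower (P s1 :\ s1)) * c
              + \sum_(s in coatoms T | (s != s1) && (P s != [set s]))
                  \sum_(B in Q s)
                    ((cd_index (semisuspension (lower (down_closure B)))
                      - cd_index (lower (lower_boundary (down_closure B))) * c) * c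
                     + cd_index (lower (lower_boundary (down_closure B))) * d)]
    & forall m : {fmonom bool}, 0 <= (cd_index T)@_m].
Proof.
have [[Phi cPhi] nn rec] := cd_index_SE hT; have [sT _] := hT.
move=> c d; split.
- exact: (cd_index_unique cPhi).1.
- move=> r1; apply: (cd_index_unique _).2.
  by rewrite /is_cd_index flag_poly_rank1 // rmorph1.
- move=> s1 P Q hP; have [r2 _ [_ _ _ S1 _] _] := hP; split=> //.
    move=> s B sc ss1 Ps BQ.
    have [|_ gL rL SL] := SE_subclass hP sc _ BQ; first by rewrite ss1.
    have dG := @down_closure_closed _ _ B.
    have [Sb rb] := S_partitionable_boundary dG gL SL.
    split=> //; first exact: S_partitionable_rank_ge2 SL.
    by rewrite rb rL prednK // ltnW.
  by have [-> _] := rec _ _ _ hP.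
- exact: nn.
Qed.
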